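(* For every integer $n\ge0$, $$\operatorname{spt}(5n+4)\equiv0\pmod5\qquad\text{and}\qquad\operatorname{spt}(7n+5)\equiv0\pmod7.$$
   Context: $\operatorname{spt}(n)$ is the total number of smallest parts among all integer partitions of $n$: that is, the sum over all partitions $\lambda$ of $n$ of the number of times the smallest part of $\lambda$ occurs in $\lambda$. For example, $\operatorname{spt}(3)=5$. *)

(* Defs.v *)
From mathcomp Require Import all_boot.

Set Implicit Arguments.
Unset Strict Implicit.
Unset Printing Implicit Defensive.

(* A partition of n is the nonincreasing sequence of its (positive) parts. *)
Definition is_partition (n : nat) (s : seq nat) : bool :=
  [&& sorted geq s, all (leq 1) s & sumn s == n].

(* The parts are listed in nonincreasing order, so the smallest one is the
   last; the default value 0 only matters for the empty partition of 0, which
   has no parts and contributes 0 to spt. *)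
Definition num_smallest_parts (s : seq nat) : nat := count_mem (last 0 s) s.

(* Partitions of n have at most n parts, each at most n, so all of them occur
   (exactly once) in the finite type n.-bseq 'I_n.+1: see partition_bseq. *)
Definition spt (n : nat) : nat :=
  \sum_(s : n.-bseq 'I_n.+1 | is_partition n (map val s))
    num_smallest_parts (map val s).

Lemma partition_bseq (n : nat) (s : seq nat) :
  is_partition n s -> exists! t : n.-bseq 'I_n.+1, map val t = s.
Proof.
case/and3P=> _ s_gt0 /eqP sum_s.
have size_s : size s <= n.
  rewrite -sum_s; elim: s s_gt0 {sum_s} => //= x s IHs /andP[x_gt0 /IHs].
  by rewrite -add1n; apply: leq_add.
have le_s x : x \in s -> x < n.+1.
  rewrite -sum_s ltnS; elim: s {s_gt0 sum_s size_s} => //= y s IHs.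
  rewrite inE => /predU1P[->|/IHs]; first exact: leq_addr.
  by move/leq_trans; apply; apply: leq_addl.
have size_t : size (map inord s : seq 'I_n.+1) <= n by rewrite size_map.
exists (Bseq size_t); split=> [|t t_s].
  rewrite /= -map_comp -[RHS]map_id.
  by apply/eq_in_map => x /le_s; apply: inordK.
apply/val_inj/(inj_map val_inj); rewrite /= t_s -map_comp -[RHS]map_id.
by apply/eq_in_map => x /le_s; apply: inordK.
Qed.

(* Main.v *)
Require Import Defs.
From mathcomp Require Import all_boot.
From HB Require Import structures.
From mathcomp Require Import all_order all_algebra.
From mathcomp Require Import boolp classical_sets fsbigop.
From mathcomp Require Import zify ring.

(** Write (q) for the Euler product.  A Bailey pair gives
    (q) sum spt(n) q^n = sum q^n / (1 - q^n)^2 + A, where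
    A = sum_(r >= 1) (-1)^r q^(r (3 r + 1) / 2) (1 + q^r) / (1 - q^r)^2,
    that is spt(n) = n p(n) + [q^n] A / (q).  Let l be 5 or 7.  Then
    A / (q) = sum_(m >= 0) (2 m + 1) (N_m - 1 / (q)), N_m being the generating
    function of the partitions of rank at most m, and the series
    f_m = (3 q d/dq + m (m + 1) / 2) N_m satisfy a three-step recurrence: this is
    the rank-crank PDE of Atkin and Garvan, whose right-hand side is the cube of
    an inverse theta function.  Modulo l that cube is theta^(l - 3) divided by a
    function of q^l, so that f_m becomes a sum over a lattice of dimension l - 3.
    On the exponents n = 4 mod 5 (n = 5 mod 7) one has 8 f_m = (2 m + 1)^2 N_m,
    hence (2 m + 1) N_m = 8 (2 m + 1)^(l - 2) f_m by Fermat, and summing over m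
    turns A / (q) into a theta series weighted by a power of the sum of the
    coordinates times its Fermat quotient (x - x^l) / l.  It vanishes modulo l on
    these exponents: for l = 5 by symmetrization over x^2 + y^2 + z^2 = 0 mod 5,
    for l = 7 because x^2 + y^2 = 0 mod 7 forces x = y = 0, up to a quartic term
    in derivatives of (q)^3 which is shown to be a derivative with the help of
    the identities of Euler and Jacobi. *)

Set Implicit Arguments.
Unset Strict Implicit.
Unset Printing Implicit Defensive.

Import GRing.Theory.
Local Open Scope ring_scope.

(** * Formal power series *)

(** The PDE itself is not proved: the recurrence of $f_m$ has at most one solution, because its
    factor $q^{m+2}$ pushes any error to higher order, so it is enough that the lattice sum solves
    the same recurrence modulo $l$. The inhomogeneous terms are combinations of $1/(q)$ and its
    derivative, and Ramanujan's congruences remove them on the chosen exponents. There the sum over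
    each residue class of the lattice index vanishes, hence also every sum weighted by an
    $l$-periodic function of the index.

    The obstacle is the summation over $m \ge 0$: it cuts the lattice along a half-space and leaves
    the weight $\lfloor x/l \rfloor$. Only the growth of this weight over a period matters, so it
    can be traded for the Fermat quotient, which is odd and additive up to an explicit polynomial.
    The weighted sum then separates into one-variable theta series, where only weights odd in every
    coordinate survive. *)

Record fps (R : Type) := Fps { coefs : nat -> R }.

HB.instance Definition _ (R : Type) := gen_eqMixin (fps R).
HB.instance Definition _ (R : Type) := gen_choiceMixin (fps R).

Lemma fpsP (R : Type) (x y : fps R) :
  (forall n, coefs x n = coefs y n) -> x = y.
Proof. by case: x y => [x] [y] /= xy; congr Fps; apply: funext. Qed.

Section FpsRing.
Variable R : comNzRingType.
Implicit Types x y z : fps R.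

Definition fps0 : fps R := Fps (fun=> 0).
Definition fps1 : fps R := Fps (fun n => (n == 0)%:R).
Definition fps_opp x := Fps (fun n => - coefs x n).
Definition fps_add x y := Fps (fun n => coefs x n + coefs y n).
Definition fps_mul x y := Fps (fun n => \sum_(i < n.+1) coefs x i * coefs y (n - i)).

Fact fps_addA : associative fps_add.
Proof. by move=> x y z; apply: fpsP => n /=; rewrite addrA. Qed.
Fact fps_addC : commutative fps_add.
Proof. by move=> x y; apply: fpsP => n /=; rewrite addrC. Qed.
Fact fps_add0 : left_id fps0 fps_add.
Proof. by move=> x; apply: fpsP => n /=; rewrite add0r. Qed.
Fact fps_addN : left_inverse fps0 fps_opp fps_add.
Proof. by move=> x; apply: fpsP => n /=; rewrite addNr. Qed.
HB.instance Definition _ :=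
  GRing.isZmodule.Build (fps R) fps_addA fps_addC fps_add0 fps_addN.

Definition trunc N x : {poly R} := \poly_(i < N) coefs x i.

(** Each coefficient of a product is computed by polynomials, so commutativity and associativity are
    inherited from [{poly R}]. *)
Lemma coef_fps_mul N x y n : (n < N)%N ->
  coefs (fps_mul x y) n = (trunc N x * trunc N y)`_n.
Proof.
move=> nN; rewrite coefM; apply: eq_bigr => i _.
by have Hi := ltn_ord i; rewrite !coef_poly !ifT //; lia.
Qed.

Fact fps_mulC : commutative fps_mul.
Proof. by move=> x y; apply: fpsP => n; rewrite !(@coef_fps_mul n.+1) // mulrC. Qed.
Fact fps_mulA : associative fps_mul.
Proof.
move=> x y z; apply: fpsP => n.
have E u v w : coefs (fps_mul (fps_mul u v) w) n
     = (trunc n.+1 u * trunc n.+1 v * trunc n.+1 w)`_n.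
  rewrite [RHS]coefM; apply: eq_bigr => i _.
  by have Hi := ltn_ord i; rewrite -(@coef_fps_mul n.+1) // coef_poly ifT //; lia.
by rewrite fps_mulC !E mulrC mulrA.
Qed.
Fact fps_mul1 : left_id fps1 fps_mul.
Proof.
move=> x; apply: fpsP => n /=; rewrite big_ord_recl /= mul1r subn0.
by rewrite big1 ?addr0 // => i _; rewrite mul0r.
Qed.
Fact fps_mulDl : left_distributive fps_mul fps_add.
Proof.
move=> x y z; apply: fpsP => n /=; rewrite -big_split /=.
by apply: eq_bigr => i _; rewrite mulrDl.
Qed.
Fact fps1_neq0 : fps1 != fps0.
Proof. by apply/eqP => /(congr1 (fun x => coefs x 0)) /eqP; rewrite /= oner_eq0. Qed.
HB.instance Definition _ := GRing.Zmodule_isComNzRing.Build (fps R)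
  fps_mulA fps_mulC fps_mul1 fps_mulDl fps1_neq0.

Definition fps_unit : {pred fps R} := fun x => `[< exists y, y * x = 1 >].
Definition fps_inv x : fps R :=
  if pselect (exists y, y * x = 1) is left e then sval (cid e) else x.
Fact fps_mulV : {in fps_unit, left_inverse 1 fps_inv *%R}.
Proof.
move=> x /asboolP e; rewrite /fps_inv; case: pselect => // e'.
by case: (cid e').
Qed.
Fact fps_unitP x y : y * x = 1 -> fps_unit x.
Proof. by move=> xy; apply/asboolP; exists y. Qed.
Fact fps_inv_out : {in [predC fps_unit], fps_inv =1 id}.
Proof. by move=> x /asboolP e; rewrite /fps_inv; case: pselect. Qed.
HB.instance Definition _ := GRing.ComNzRing_hasMulInverse.Build (fps R)
  fps_mulV fps_unitP fps_inv_out.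

Lemma coefs0 n : coefs (0 : fps R) n = 0. Proof. by []. Qed.
Lemma coefs1 n : coefs (1 : fps R) n = (n == 0)%:R. Proof. by []. Qed.
Lemma coefsD x y n : coefs (x + y) n = coefs x n + coefs y n. Proof. by []. Qed.
Lemma coefsN x n : coefs (- x) n = - coefs x n. Proof. by []. Qed.
Lemma coefsB x y n : coefs (x - y) n = coefs x n - coefs y n. Proof. by []. Qed.
Lemma coefsM x y n :
  coefs (x * y) n = \sum_(i < n.+1) coefs x i * coefs y (n - i).
Proof. by []. Qed.

Lemma coefs_sum I (r : seq I) (P : pred I) (F : I -> fps R) n :
  coefs (\sum_(i <- r | P i) F i) n = \sum_(i <- r | P i) coefs (F i) n.
Proof. by elim/big_rec2: _ => // i x y _ <-. Qed.
Lemma coefsMn x m n : coefs (x *+ m) n = coefs x n *+ m.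
Proof. by elim: m => // m IH; rewrite !mulrS coefsD IH. Qed.
Lemma coefs_natM x m n : coefs (m%:R * x) n = m%:R * coefs x n.
Proof. by rewrite !mulr_natl coefsMn. Qed.
Lemma coefs_intM x (m : int) n : coefs (m%:~R * x) n = m%:~R * coefs x n.
Proof.
by case: m => m; rewrite ?NegzE ?mulrNz ?mulNr ?coefsN -?pmulrn ?coefs_natM.
Qed.

Definition qpow m : fps R := Fps (fun n => (n == m)%:R).
Arguments qpow m%_N.
Lemma coef_qpowM m x n :
  coefs (qpow m * x) n = if (m <= n)%N then coefs x (n - m) else 0.
Proof.
rewrite coefsM /=; case: leqP => mn.
  rewrite (bigD1 (inord m)) //= inordK ?eqxx ?mul1r ?ltnS // big1 ?addr0 //.
  move=> i /eqP im; case: eqP => [e|]; rewrite ?mul0r //.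
  by case: im; apply: val_inj; rewrite /= inordK.
rewrite big1 // => i _; case: eqP => [e|]; rewrite ?mul0r //; have Hi := ltn_ord i; lia.
Qed.
Lemma qpowD m n : qpow (m + n) = qpow m * qpow n.
Proof.
apply: fpsP => k; rewrite coef_qpowM /=; case: leqP => mk.
  by have -> : (k == m + n)%N = (k - m == n)%N by lia.
by case: eqP => // e; lia.
Qed.
Lemma qpow0 : qpow 0 = 1. Proof. by []. Qed.
Lemma qpowX m n : qpow m ^+ n = qpow (n * m).
Proof. by elim: n => // n IH; rewrite exprS IH -qpowD. Qed.
Lemma qpowM_inj m : injective ( *%R (qpow m)).
Proof.
move=> x y e; apply: fpsP => n.
have : coefs (qpow m * x) (m + n) = coefs (qpow m * y) (m + n) by rewrite e.
by rewrite !coef_qpowM leq_addr addKn.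
Qed.

(* The order of vanishing at q = 0 is at least N. *)
Definition ordge N x := [forall n : 'I_N, coefs x n == 0].

Lemma ordgeP N x : reflect (forall n, (n < N)%N -> coefs x n = 0) (ordge N x).
Proof.
apply: (iffP forallP) => [xN n nN|xN n]; last by apply/eqP/xN.
exact: (eqP (xN (Ordinal nN))).
Qed.
Lemma ordge0 x : ordge 0 x. Proof. exact/ordgeP. Qed.
Lemma ordge_0 N : ordge N 0. Proof. exact/ordgeP. Qed.
Lemma ordge_qpow m : ordge m (qpow m).
Proof. by apply/ordgeP => n nm /=; case: eqP => // e; lia. Qed.
Lemma ordgeW M N x : (M <= N)%N -> ordge N x -> ordge M x.
Proof. by move=> MN /ordgeP xN; apply/ordgeP => n nM; apply: xN; lia. Qed.
Lemma ordgeD N x y : ordge N x -> ordge N y -> ordge N (x + y).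
Proof.
by move=> /ordgeP xN /ordgeP yN; apply/ordgeP => n nN; rewrite coefsD xN ?yN ?addr0.
Qed.
Lemma ordgeN N x : ordge N x -> ordge N (- x).
Proof. by move=> /ordgeP xN; apply/ordgeP => n nN; rewrite coefsN xN ?oppr0. Qed.
Lemma ordgeB N x y : ordge N x -> ordge N y -> ordge N (x - y).
Proof. by move=> xN /ordgeN; apply: ordgeD. Qed.
Lemma ordgeM M N x y : ordge M x -> ordge N y -> ordge (M + N) (x * y).
Proof.
move=> /ordgeP xM /ordgeP yN; apply/ordgeP => n nMN; rewrite coefsM big1 // => i _.
have Hi := ltn_ord i.
by have [iM|iM] := ltnP i M; [rewrite xM ?mul0r|rewrite yN ?mulr0 //; lia].
Qed.
Lemma ordgeMl N x y : ordge N x -> ordge N (x * y).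
Proof. by move=> xN; rewrite -[N]addn0; apply: ordgeM (ordge0 _). Qed.
Lemma ordgeMr N x y : ordge N y -> ordge N (x * y).
Proof. by rewrite mulrC; apply: ordgeMl. Qed.
Lemma ordge_sum N I (r : seq I) (P : pred I) (F : I -> fps R) :
  (forall i, P i -> ordge N (F i)) -> ordge N (\sum_(i <- r | P i) F i).
Proof.
move=> FN; apply/ordgeP => n nN; rewrite coefs_sum big1 // => i /FN/ordgeP.
exact.
Qed.
Lemma ordge_eq0 x : (forall N, ordge N x) -> x = 0.
Proof. by move=> xN; apply: fpsP => n; apply: (ordgeP _ _ (xN n.+1)). Qed.
Lemma ordge_eq x y : (forall N, ordge N (x - y)) -> x = y.
Proof. by move/ordge_eq0/eqP; rewrite subr_eq0 => /eqP. Qed.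

(** The inverse is the geometric series; [x ^+ k] has order at least [k], so its coefficient in
    degree [n] is already that of the partial sum up to [k = n]. *)
Lemma fps_unit_1B x : ordge 1 x -> 1 - x \is a GRing.unit.
Proof.
move=> x1; have xX k : ordge k (x ^+ k).
  elim: k => [|k IH]; first exact: ordge0.
  by rewrite exprS -add1n; apply: ordgeM.
pose y := Fps (fun n => coefs (\sum_(k < n.+1) x ^+ k) n).
have yE n : ordge n.+1 (y - \sum_(k < n.+1) x ^+ k).
  apply/ordgeP => m mn; rewrite coefsB -(subnKC mn) big_split_ord coefsD opprD addrA.
  rewrite [X in X - _]subrr coefs_sum big1 ?subr0 // => i _.
  by apply: (ordgeP _ _ (xX _)) => /=; rewrite ltnS leq_addr.
apply/unitrPr; exists y; apply: ordge_eq => n; apply: (@ordgeW _ n.+1) => //.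
rewrite -[y](subrK (\sum_(k < n.+1) x ^+ k)) mulrDr -addrA.
apply: ordgeD; first exact/ordgeMr/yE.
rewrite -(opprB x 1) mulNr -subrX1 opprB addrAC subrr add0r.
by apply: ordgeN; apply: xX.
Qed.

Lemma unit_1Bq n : (0 < n)%N -> 1 - qpow n \is a GRing.unit.
Proof. by move=> n0; apply: fps_unit_1B; apply: ordgeW (ordge_qpow n). Qed.

End FpsRing.
Arguments qpow {R} m%_N.

(** * Derivation, residue classes of exponents, infinite sums *)

Section Derivation.
Variable R : comNzRingType.
Implicit Types x y z : fps R.

Definition qD x : fps R := Fps (fun n => n%:R * coefs x n).
Lemma coef_qD x n : coefs (qD x) n = n%:R * coefs x n. Proof. by []. Qed.
Lemma qD_is_additive : zmod_morphism qD.
Proof. by move=> x y; apply: fpsP => n; rewrite coef_qD !coefsB !coef_qD mulrBr. Qed.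
HB.instance Definition _ := GRing.isZmodMorphism.Build _ _ qD qD_is_additive.
Lemma qDM x y : qD (x * y) = qD x * y + x * qD y.
Proof.
apply: fpsP => n; rewrite coef_qD coefsD !coefsM mulr_sumr -big_split /=.
apply: eq_bigr => i _.
have {1}-> : n = (i + (n - i))%N by have Hi := ltn_ord i; lia.
by rewrite natrD; ring.
Qed.
Lemma qD1 : qD 1 = 0.
Proof. by apply: fpsP => -[|n]; rewrite coef_qD coefs1 ?mul0r ?mulr0. Qed.
Lemma qD_nat n : qD n%:R = 0. Proof. by rewrite raddfMn /= qD1 mul0rn. Qed.
Lemma qD_int (n : int) : qD n%:~R = 0.
Proof. by rewrite raddfMz /= qD1 mul0rz. Qed.
Lemma qDX x n : qD (x ^+ n) = n%:R * x ^+ n.-1 * qD x.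
Proof.
elim: n => [|[|n] IH]; rewrite ?expr0 ?qD1 ?mul0r ?expr1 ?mul1r //.
by rewrite exprS qDM IH /= [x ^+ n.+1]exprS -(natr1 n.+1); ring.
Qed.
Lemma qDV x : x \is a GRing.unit -> qD x^-1 = - x^-1 ^+ 2 * qD x.
Proof.
move=> xu; have /(congr1 qD) := divrr xu; rewrite qDM qD1 => /(canRL (addKr _)).
by rewrite addr0 => /(canRL (mulKr xu)) ->; ring.
Qed.
Lemma qD_qpow n : qD (qpow n) = n%:R * qpow n :> fps R.
Proof.
apply: fpsP => m; rewrite coef_qD coefs_natM /=.
by case: eqP => [->|]; rewrite ?mulr0.
Qed.
Lemma ordge_qD N x : ordge N x -> ordge N (qD x).
Proof. by move=> /ordgeP xN; apply/ordgeP => n nN; rewrite coef_qD xN ?mulr0. Qed.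

End Derivation.

Section Projection.
Variables (R : comNzRingType) (p r : nat).
Implicit Types x y z : fps R.

(* The part of a series carried by the exponents congruent to [r] mod [p]. *)
Definition pr x : fps R := Fps (fun n => if (n == r %[mod p])%N then coefs x n else 0).
Lemma coef_pr x n : coefs (pr x) n = if (n == r %[mod p])%N then coefs x n else 0.
Proof. by []. Qed.
Lemma pr_is_additive : zmod_morphism pr.
Proof.
by move=> x y; apply: fpsP => n; rewrite coef_pr !coefsB !coef_pr; case: eqP; rewrite ?subr0.
Qed.
HB.instance Definition _ := GRing.isZmodMorphism.Build _ _ pr pr_is_additive.

(* Power series in q^p. *)
Definition in_qp x : bool := `[< forall n, ~~ (p %| n)%N -> coefs x n = 0 >].
Lemma in_qpP x : reflect (forall n, ~~ (p %| n)%N -> coefs x n = 0) (in_qp x).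
Proof. exact: asboolP. Qed.
Lemma pr_in_qpM x y : in_qp x -> pr (x * y) = x * pr y.
Proof.
move=> /in_qpP xp; apply: fpsP => n; rewrite coef_pr !coefsM.
have E (i : 'I_n.+1) : coefs x i * coefs (pr y) (n - i) =
    if (n == r %[mod p])%N then coefs x i * coefs y (n - i) else 0.
  have [pi|/xp->] := boolP (p %| i)%N; last by rewrite !mul0r; case: ifP.
  have in' : (i <= n)%N by rewrite -ltnS.
  have -> : (n %% p = (n - i) %% p)%N.
    by rewrite -{1}(subnK in') -modnDmr (eqP pi) addn0.
  rewrite coef_pr.
  by case: ifP => _; rewrite ?mulr0.
by under [RHS]eq_bigr do rewrite E; case: ifP => _ //; rewrite big1.
Qed.
Lemma in_qp_qpow n : (p %| n)%N -> in_qp (qpow n).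
Proof. by move=> pn; apply/in_qpP => m /=; have [->|//] := eqVneq m n; rewrite pn. Qed.
End Projection.

(** * Infinite sums of power series *)

Section GSum.
Variable R : comNzRingType.

Definition summable (I : choiceType) (F : I -> fps R) :=
  forall n, exists s : seq I, forall i, i \notin s -> coefs (F i) n = 0.

(** In each degree this is a sum over the support, with default value 0 when the support is
    infinite; hence the [summable] hypotheses below. *)
Definition gsum (I : choiceType) (F : I -> fps R) : fps R :=
  Fps (fun n => \sum_(i \in [set: I]) coefs (F i) n).

Arguments gsum : simpl never.

Lemma coef_gsum (I : choiceType) (F : I -> fps R) n (s : seq I) :
  uniq s -> (forall i, i \notin s -> coefs (F i) n = 0) ->
  coefs (gsum F) n = \sum_(i <- s) coefs (F i) n.
Proof.
move=> us Fs; rewrite [LHS](fsbigE s) //; first by apply: eq_bigl => i; rewrite mem_set.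
by move=> i _; apply: Fs.
Qed.

Lemma summableP (I : choiceType) (F : I -> fps R) : summable F ->
  forall n, exists s : seq I, uniq s /\ forall i, i \notin s -> coefs (F i) n = 0.
Proof.
by move=> Fs n; have [s sF] := Fs n; exists (undup s); split=> [|i];
  rewrite ?undup_uniq // mem_undup; apply: sF.
Qed.

Lemma eq_gsum (I : choiceType) (F G : I -> fps R) : F =1 G -> gsum F = gsum G.
Proof. by move=> /funext ->. Qed.

Lemma eq_summable (I : choiceType) (F G : I -> fps R) :
  F =1 G -> summable F -> summable G.
Proof. by move=> /funext ->. Qed.

Lemma summableD (I : choiceType) (F G : I -> fps R) :
  summable F -> summable G -> summable (fun i => F i + G i).
Proof.
move=> Fs Gs n; have [s sF] := Fs n; have [t tG] := Gs n.
by exists (s ++ t) => i; rewrite mem_cat negb_or coefsD => /andP[/sF-> /tG->]; rewrite addr0.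
Qed.

Lemma gsumD (I : choiceType) (F G : I -> fps R) :
  summable F -> summable G -> gsum (fun i => F i + G i) = gsum F + gsum G.
Proof.
move=> Fs Gs; apply: fpsP => n; have [s sF] := Fs n; have [t tG] := Gs n.
have us := undup_uniq (s ++ t); rewrite coefsD.
rewrite !(coef_gsum us) -?big_split // => i; rewrite mem_undup mem_cat negb_or => /andP[].
- by move=> _ /tG.
- by move=> /sF.
- by move=> /sF Fi /tG Gi; rewrite coefsD Fi Gi addr0.
Qed.

Lemma summableN (I : choiceType) (F : I -> fps R) :
  summable F -> summable (fun i => - F i).
Proof. by move=> Fs n; have [s sF] := Fs n; exists s => i /sF; rewrite coefsN => ->; rewrite oppr0. Qed.

Lemma gsumN (I : choiceType) (F : I -> fps R) :
  summable F -> gsum (fun i => - F i) = - gsum F.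
Proof.
move=> Fs; apply: fpsP => n; have [s [us sF]] := summableP Fs n.
rewrite coefsN !(coef_gsum us) // -?sumrN // => i /sF; rewrite coefsN => ->.
by rewrite oppr0.
Qed.

Lemma gsumB (I : choiceType) (F G : I -> fps R) :
  summable F -> summable G -> gsum (fun i => F i - G i) = gsum F - gsum G.
Proof. by move=> Fs Gs; rewrite gsumD ?gsumN //; apply: summableN. Qed.

(** One finite set of indices serves all degrees below [n]. This is equivalent to [summable], and it
    is the form that passes to products. *)
Definition usummable (I : choiceType) (F : I -> fps R) :=
  forall n, exists s : seq I, forall i, i \notin s -> ordge n (F i).

Lemma summable_usummable (I : choiceType) (F : I -> fps R) : summable F -> usummable F.
Proof.
move=> Fs n; have [f fF] := choice Fs.
exists (flatten [seq f m | m <- iota 0 n]) => i iN; apply/ordgeP => m mn.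
apply: fF; apply: contra iN => im; apply/flattenP; exists (f m) => //.
by apply/mapP; exists m; rewrite ?mem_iota.
Qed.
Lemma usummable_summable (I : choiceType) (F : I -> fps R) : usummable F -> summable F.
Proof.
move=> Fu n; have [s sF] := Fu n.+1; exists s => i /sF /ordgeP.
exact.
Qed.

Lemma summableMr (I : choiceType) (F : I -> fps R) (x : I -> fps R) :
  summable F -> summable (fun i => x i * F i).
Proof.
move=> /summable_usummable Fu; apply: usummable_summable => n.
by have [s sF] := Fu n; exists s => i /sF; apply: ordgeMr.
Qed.

Lemma gsumMl (I : choiceType) (F : I -> fps R) (x : fps R) :
  summable F -> gsum (fun i => x * F i) = x * gsum F.
Proof.
move=> Fs; apply: fpsP => n; have [s0 sF0] := summable_usummable Fs n.+1.
have us := undup_uniq s0; set s := undup s0 in us.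
have sF i m : i \notin s -> (m <= n)%N -> coefs (F i) m = 0.
  by rewrite mem_undup => /sF0 /ordgeP + mn; apply.
rewrite (coef_gsum us) => [|i si]; last first.
  by rewrite coefsM big1 // => j _; rewrite sF ?mulr0 ?leq_subr.
rewrite coefsM; under eq_bigr do rewrite coefsM.
rewrite exchange_big /=; apply: eq_bigr => j _; rewrite -mulr_sumr; congr (_ * _).
symmetry; apply: (coef_gsum us) => i si; apply: sF; rewrite ?leq_subr //.
Qed.

Lemma gsumMr (I : choiceType) (F : I -> fps R) (x : fps R) :
  summable F -> gsum (fun i => F i * x) = gsum F * x.
Proof. by move=> Fs; rewrite mulrC -gsumMl //; apply: eq_gsum => i; rewrite mulrC. Qed.

Lemma summable_reindex (I J : choiceType) (f : J -> I) (F : I -> fps R) :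
  bijective f -> summable F -> summable (F \o f).
Proof.
move=> [g fK gK] Fs n; have [s sF] := Fs n; exists (map g s) => j js /=.
apply: sF; apply: contra js => js; rewrite -[j]fK; exact: map_f.
Qed.

Lemma gsum_reindex (I J : choiceType) (f : J -> I) (F : I -> fps R) :
  bijective f -> gsum F = gsum (F \o f).
Proof. by move=> fb; apply: fpsP => n; apply: reindex_fsbigT. Qed.

Lemma coef_gsum_u (I : choiceType) (F : I -> fps R) N (s : seq I) :
  uniq s -> (forall i, i \notin s -> ordge N (F i)) ->
  ordge N (gsum F - \sum_(i <- s) F i).
Proof.
move=> us Fs; apply/ordgeP => n nN; rewrite coefsB (coef_gsum us) ?coefs_sum ?subrr //.
by move=> i /Fs/ordgeP; apply.
Qed.

Lemma gsum_pair (I J : choiceType) (F : I -> J -> fps R) :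
  summable (fun a : I * J => F a.1 a.2) ->
  gsum (fun i => gsum (F i)) = gsum (fun a : I * J => F a.1 a.2).
Proof.
move=> Fs; apply: fpsP => n; have [t tF] := Fs n.
pose s1 := undup (map fst t); pose s2 := undup (map snd t).
have us1 : uniq s1 := undup_uniq _; have us2 : uniq s2 := undup_uniq _.
have F1 i j : i \notin s1 -> coefs (F i j) n = 0.
  rewrite mem_undup => is1; apply: (tF (i, j)); apply: contra is1 => ijt.
  by apply/mapP; exists (i, j).
have F2 i j : j \notin s2 -> coefs (F i j) n = 0.
  rewrite mem_undup => is1; apply: (tF (i, j)); apply: contra is1 => ijt.
  by apply/mapP; exists (i, j).
rewrite (coef_gsum us1) => [|i is1]; last first.
  by rewrite (coef_gsum us2) ?big1 // => j _; [apply: F1|exact: F1].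
rewrite (@coef_gsum _ _ _ (allpairs pair s1 s2)) ?allpairs_uniq //.
- rewrite big_allpairs; apply: eq_bigr => i _; rewrite (coef_gsum us2) // => j.
  exact: F2.
- by move=> [i j] [i' j'] _ _ [-> ->].
move=> [i j] /= ijs; have [is1|is1] := boolP (i \in s1); last exact: F1.
apply: F2; apply: contra ijs => js2; exact: allpairs_f.
Qed.

Lemma summable_pairMM (I J : choiceType) (F : I -> fps R) (G : J -> fps R) :
  summable F -> summable G -> summable (fun a : I * J => F a.1 * G a.2).
Proof.
move=> /summable_usummable Fu /summable_usummable Gu; apply: usummable_summable => n.
have [s sF] := Fu n; have [t tG] := Gu n; exists (allpairs pair s t) => -[i j] /= ij.
have [si|/sF] := boolP (i \in s); last exact: ordgeMl.
apply: ordgeMr; apply: tG; apply: contra ij; exact: allpairs_f.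
Qed.

Lemma gsumMM (I J : choiceType) (F : I -> fps R) (G : J -> fps R) :
  summable F -> summable G ->
  gsum (fun a : I * J => F a.1 * G a.2) = gsum F * gsum G.
Proof.
move=> Fs Gs; have := summable_pairMM Fs Gs => FG.
rewrite -(@gsum_pair _ _ (fun i j => F i * G j)) // -gsumMr //.
by apply: eq_gsum => i; rewrite gsumMl.
Qed.

Lemma summable_swap (I J : choiceType) (F : I * J -> fps R) :
  summable F -> summable (fun a : J * I => F (a.2, a.1)).
Proof.
by apply: (@summable_reindex _ _ (fun a : J * I => (a.2, a.1))); exists (fun a => (a.2, a.1)); case.
Qed.

Lemma gsum_exchange (I J : choiceType) (F : I -> J -> fps R) :
  summable (fun a : I * J => F a.1 a.2) ->
  gsum (fun i => gsum (F i)) = gsum (fun j => gsum (F^~ j)).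
Proof.
move=> Fs; rewrite gsum_pair // gsum_pair; last exact: summable_swap Fs.
by apply: (@gsum_reindex _ _ (fun a : J * I => (a.2, a.1))); exists (fun a => (a.2, a.1)); case.
Qed.

Lemma ordge_gsum (I : choiceType) (F : I -> fps R) N :
  (forall i, ordge N (F i)) -> ordge N (gsum F).
Proof.
move=> FN; apply/ordgeP => n nN; rewrite (@coef_gsum _ _ _ [::]) ?big_nil //.
by move=> i _; apply: (ordgeP _ _ (FN i)).
Qed.

Lemma gsum_eq0 (I : choiceType) (F : I -> fps R) : (forall i, F i = 0) -> gsum F = 0.
Proof. by move=> F0; apply: ordge_eq0 => N; apply: ordge_gsum => i; rewrite F0 ordge_0. Qed.

Lemma gsum1 (I : choiceType) (F : I -> fps R) i0 :
  (forall i, i != i0 -> F i = 0) -> gsum F = F i0.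
Proof.
move=> F0; apply: fpsP => n; rewrite (@coef_gsum _ _ _ [:: i0]) ?big_seq1 //.
by move=> i; rewrite inE => /F0 ->.
Qed.

Lemma gsum_qD (I : choiceType) (F : I -> fps R) :
  summable F -> qD (gsum F) = gsum (fun i => qD (F i)).
Proof.
move=> Fs; apply: fpsP => n; have [s [us sF]] := summableP Fs n.
rewrite coef_qD !(coef_gsum us) // ?mulr_sumr // => i /sF; rewrite coef_qD => ->.
by rewrite mulr0.
Qed.
Lemma gsum_pr p r (I : choiceType) (F : I -> fps R) :
  summable F -> pr p r (gsum F) = gsum (fun i => pr p r (F i)).
Proof.
move=> Fs; apply: fpsP => n; have [s [us sF]] := summableP Fs n.
rewrite coef_pr !(coef_gsum us) // => [|i /sF]; last by rewrite coef_pr => ->; case: ifP.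
case: ifP => nr; last by rewrite big1 // => i _; rewrite coef_pr nr.
by apply: eq_bigr => i _; rewrite coef_pr nr.
Qed.
Lemma summable_qD (I : choiceType) (F : I -> fps R) :
  summable F -> summable (fun i => qD (F i)).
Proof. by move=> Fs n; have [s sF] := Fs n; exists s => i /sF; rewrite coef_qD => ->; rewrite mulr0. Qed.
Lemma summable_pr p r (I : choiceType) (F : I -> fps R) :
  summable F -> summable (fun i => pr p r (F i)).
Proof. by move=> Fs n; have [s sF] := Fs n; exists s => i /sF; rewrite coef_pr => ->; case: ifP. Qed.

Lemma summable_nat (F : nat -> fps R) : (forall i, ordge i (F i)) -> summable F.
Proof.
move=> Fo; apply: usummable_summable => n; exists (iota 0 n) => i.
by rewrite mem_iota /= add0n -leqNgt => ni; apply: ordgeW ni (Fo i).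
Qed.
End GSum.

(** * q-products and Lambert series *)

Section QSeries.
Variable R : comNzRingType.
Implicit Types x y z : fps R.

Lemma gsum_trunc (F : nat -> fps R) N : (forall i, ordge i (F i)) ->
  ordge N (gsum F - \sum_(i < N) F i).
Proof.
move=> Fo; rewrite -(big_mkord xpredT F) /index_iota subn0.
apply: coef_gsum_u (iota_uniq 0 N) _ => i.
by rewrite mem_iota add0n -leqNgt => Ni; apply: ordgeW Ni (Fo i).
Qed.

Lemma gsum_limit (F : nat -> fps R) x : (forall i, ordge i (F i)) ->
  (forall N, ordge N (x - \sum_(i < N) F i)) -> x = gsum F.
Proof.
move=> Fo xF; apply: ordge_eq => N.
set S := \sum_(i < N) F i; have -> : x - gsum F = (x - S) - (gsum F - S) by ring.
by apply: ordgeB; [apply: xF|apply: gsum_trunc].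
Qed.

Definition qp n : fps R := \prod_(i < n) (1 - qpow i.+1).
Definition iq n : fps R := (qp n)^-1.

Lemma qpS n : qp n.+1 = qp n * (1 - qpow n.+1).
Proof. by rewrite /qp big_ord_recr. Qed.
Lemma qp0 : qp 0 = 1. Proof. exact: big_ord0. Qed.
Lemma qp_unit n : qp n \is a GRing.unit.
Proof. by elim: n => [|n IH]; rewrite ?qp0 ?unitr1 // qpS unitrM IH unit_1Bq. Qed.
Lemma iqE n : iq n = (1 - qpow n.+1) * iq n.+1.
Proof. by rewrite /iq qpS invrM ?qp_unit ?unit_1Bq // mulrA divrr ?unit_1Bq // mul1r. Qed.
Lemma qpK n : qp n * iq n = 1. Proof. by rewrite divrr ?qp_unit. Qed.
Lemma iq0 : iq 0 = 1. Proof. by rewrite /iq qp0 invr1. Qed.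

(** Factors beyond the [n]-th do not affect degree [n], so this diagonal is the infinite product. *)
Definition pinf : fps R := Fps (fun n => coefs (qp n) n).
Local Notation P := pinf.

Lemma qp_pinf n : ordge n.+1 (qp n - P).
Proof.
apply/ordgeP => m mn; rewrite coefsB -(subnKC (mn : (m <= n)%N)).
elim: (n - m)%N => [|d IH]; first by rewrite addn0 subrr.
rewrite addnS qpS mulrBr mulr1 coefsB mulrC coef_qpowM ifN ?subr0 //; lia.
Qed.

Lemma pinf_unit : P \is a GRing.unit.
Proof.
have -> : P = 1 - (1 - P) by rewrite opprB addrC subrK.
by apply: fps_unit_1B; rewrite -qp0; apply: qp_pinf.
Qed.
Lemma iq_pinf n : ordge n.+1 (iq n - P^-1).
Proof.
have -> : iq n - P^-1 = - (iq n * P^-1 * (qp n - P)).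
  have -> : - (iq n * P^-1 * (qp n - P)) = - P^-1 * (qp n * iq n) + iq n * (P^-1 * P).
    by ring.
  by rewrite qpK mulVr ?pinf_unit //; ring.
by apply/ordgeN/ordgeMr/qp_pinf.
Qed.

Lemma geom_gsum m : (0 < m)%N -> (1 - qpow m) * gsum (fun j => qpow (j * m)) = 1 :> fps R.
Proof.
move=> m0; apply: ordge_eq => N.
have o : forall i, ordge i (qpow (i * m) : fps R).
  by move=> i; apply: ordgeW (ordge_qpow _ _); rewrite leq_pmulr.
have -> : (1 - qpow m) * gsum (fun j => qpow (j * m)) - 1 =
   (1 - qpow m) * (gsum (fun j => qpow (j * m)) - \sum_(i < N) qpow (i * m))
   - qpow (N * m) :> fps R.
  have E : (1 - qpow m) * (\sum_(i < N) qpow (i * m)) = 1 - qpow (N * m) :> fps R.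
    rewrite -(opprB (qpow m)) -qpowX mulNr.
    by under eq_bigr do rewrite -qpowX; rewrite -subrX1 opprB.
  by rewrite mulrBr E opprB; ring.
by apply: ordgeB; [apply/ordgeMr/gsum_trunc|apply: o].
Qed.

Lemma geom2_gsum m : (0 < m)%N ->
  (1 - qpow m) ^+ 2 * gsum (fun j => j.+1%:R * qpow (j * m)) = 1 :> fps R.
Proof.
move=> m0; rewrite expr2 -mulrA -[RHS](geom_gsum m0); congr (_ * _).
have o : forall i, ordge i (qpow (i * m) : fps R).
  by move=> i; apply: ordgeW (ordge_qpow _ _); rewrite leq_pmulr.
apply: gsum_limit => // N.
have E : (1 - qpow m) * (\sum_(i < N) i.+1%:R * qpow (i * m)) =
    \sum_(i < N) qpow (i * m) - N%:R * qpow (N * m) :> fps R.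
  elim: N => [|N IH]; first by rewrite !big_ord0 mulr0 mul0r subr0.
  rewrite !big_ord_recr /= mulrDr IH mulSn qpowD -natr1; ring.
have -> : (1 - qpow m) * gsum (fun j => j.+1%:R * qpow (j * m))
    - \sum_(i < N) qpow (i * m) =
   (1 - qpow m) * (gsum (fun j => j.+1%:R * qpow (j * m))
     - \sum_(i < N) i.+1%:R * qpow (i * m)) - N%:R * qpow (N * m) :> fps R.
  by rewrite mulrBr E; ring.
apply: ordgeB; last exact: ordgeMr.
by apply/ordgeMr/gsum_trunc => i; apply: ordgeMr.
Qed.

Definition lam : fps R := gsum (fun n => qpow n.+1 * (1 - qpow n.+1)^-1 ^+ 2).

(** Both series expand into the double sum of $n q^{nj}$, taken in the two orders. *)
Lemma lamE : lam = gsum (fun n => n.+1%:R * (qpow n.+1 * (1 - qpow n.+1)^-1)).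
Proof.
have E1 n : (1 - qpow n.+1)^-1 = gsum (fun j => qpow (j * n.+1)) :> fps R.
  have := congr1 ( *%R (1 - qpow n.+1)^-1) (geom_gsum (ltn0Sn n)).
  by rewrite mulKr ?unit_1Bq // mulr1.
have E2 n : (1 - qpow n.+1)^-1 ^+ 2 = gsum (fun j => j.+1%:R * qpow (j * n.+1)) :> fps R.
  have := congr1 ( *%R ((1 - qpow n.+1) ^+ 2)^-1) (geom2_gsum (ltn0Sn n)).
  by rewrite mulKr ?unitrX ?unit_1Bq // mulr1 exprVn.
have s1 : summable (fun a : nat * nat => (a.1.+1%:R * qpow (a.1.+1 * a.2.+1) : fps R)).
  move=> n; exists (allpairs pair (iota 0 n) (iota 0 n)) => -[i j] ij.
  rewrite coefs_natM /=; case: eqP => [e|]; rewrite ?mulr0 //.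
  by case/negP: ij; apply: allpairs_f; rewrite mem_iota; nia.
have so m : summable (fun j => (qpow (j * m.+1) : fps R)).
  by apply: summable_nat => i; apply: ordgeW (ordge_qpow _ _); rewrite leq_pmulr.
have -> : lam = gsum (fun n => gsum (fun j => j.+1%:R * qpow (j.+1 * n.+1))).
  apply: eq_gsum => n; rewrite E2 -gsumMl; last exact: summableMr.
  by apply: eq_gsum => j; rewrite mulSn qpowD; ring.
rewrite gsum_exchange; last first.
  exact: (@summable_swap _ _ _ _ s1).
apply: eq_gsum => n; rewrite E1 -!gsumMl; last 2 first.
- by apply: summableMr.
- exact: so.
by apply: eq_gsum => j; rewrite mulnC mulSn qpowD; ring.
Qed.

(** Logarithmic derivative of the Euler product; division by $(q)$ turns [lam] into the series of
    $n\,p(n)$. *)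
Lemma lam_pinf : lam = P * qD P^-1.
Proof.
rewrite qDV ?pinf_unit //.
have E n : qD (qp n) = - qp n * \sum_(i < n) i.+1%:R * (qpow i.+1 * (1 - qpow i.+1)^-1).
  elim: n => [|n IH]; first by rewrite qp0 qD1 big_ord0 mulr0.
  have u := divrr (unit_1Bq R (ltn0Sn n)).
  rewrite qpS qDM IH big_ord_recr raddfB /= qD1 qD_qpow sub0r.
  set S := \sum_(i < n) _; set v := _^-1 in u *.
  have -> : - (qp n * (1 - qpow n.+1)) * (S + n.+1%:R * (qpow n.+1 * v)) =
    - qp n * S * (1 - qpow n.+1) - qp n * (n.+1%:R * qpow n.+1) * ((1 - qpow n.+1) * v).
    by ring.
  by rewrite u; ring.
have -> : P * (- P^-1 ^+ 2 * qD P) = - P^-1 * qD P.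
  by rewrite mulrA mulrN expr2 mulrA divrr ?pinf_unit // mul1r.
rewrite lamE; symmetry; apply: gsum_limit => [i|N].
  by apply: ordgeMr; apply: ordgeMl; apply: ordgeW (ordge_qpow _ _).
have -> : - P^-1 * qD P - \sum_(i < N) i.+1%:R * (qpow i.+1 * (1 - qpow i.+1)^-1)
  = - P^-1 * (qD (P - qp N) + (P - qp N) *
     \sum_(i < N) i.+1%:R * (qpow i.+1 * (1 - qpow i.+1)^-1)).
  rewrite raddfB /= E; set s := \sum_(i < N) _; have u := mulVr pinf_unit.
  by rewrite -[s in LHS]mul1r -u; ring.
have o : ordge N (P - qp N).
  by rewrite -opprB; apply/ordgeN/(ordgeW (leqnSn N))/qp_pinf.
by apply/ordgeMr/ordgeD; [apply: ordge_qD|apply: ordgeMl].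
Qed.

End QSeries.
Arguments qp {R} n%_N.
Arguments iq {R} n%_N.
Arguments pinf {R}.

(** * The Bailey pair behind spt *)

Section Bailey.
Variable R : comNzRingType.
Implicit Types x y z : fps R.
Local Notation P := (@pinf R).

(** With [qpow 1] abstracted as a variable, [ring] can compare powers of $q$ in the telescoping
    identities. *)
Lemma qpowS : exists q1 : fps R, forall m, qpow m.+1 = q1 * qpow m.
Proof. by exists (qpow 1) => m; rewrite -qpowD add1n. Qed.

Definition pent (r : nat) : nat := ((r * (3 * r - 1)) %/ 2)%N.
Lemma pentS r : pent r.+1 = (pent r + (3 * r).+1)%N.
Proof.
rewrite /pent; have -> : (r.+1 * (3 * r.+1 - 1) = r * (3 * r - 1) + (3 * r).+1 * 2)%N.
  by case: r => // r; nia.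
by rewrite divnDMl.
Qed.

Definition alpha (r : nat) : fps R :=
  if r == 0%N then 1 else (-1) ^+ r * qpow (pent r) * (1 + qpow r).
Lemma alphaS r : alpha r.+1 = (-1) ^+ r.+1 * qpow (pent r.+1) * (1 + qpow r.+1).
Proof. by []. Qed.

(* The defect of the recurrence in [n] of the partial sums telescopes. *)
Lemma bailey_partial n k : (k <= n)%N ->
  (1 - qpow n.+1) * (\sum_(r < k.+1) alpha r * iq (n.+1 - r) * iq (n.+1 + r)) -
    \sum_(r < k.+1) alpha r * iq (n - r) * iq (n + r) =
  (-1) ^+ k * qpow (pent k.+1) * iq (n - k) * iq (n.+1 + k) * qpow (n - k).
Proof.
elim: k => [_|k IH kn].
  rewrite !big_ord1 !subn0 !addn0 /alpha /= /pent /= (iqE R n).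
  by rewrite -addn1 qpowD; ring.
rewrite !(big_ord_recr k.+1) /= mulrDr opprD addrACA IH ?(ltnW kn) // !alphaS.
have -> : (n = k.+1 + (n - k.+1))%N by lia.
set d := (n - k.+1)%N.
have -> : ((k.+1 + d).+1 - k.+1 = d.+1)%N by lia.
have -> : ((k.+1 + d) - k.+1 = d)%N by lia.
have -> : ((k.+1 + d) - k = d.+1)%N by lia.
have -> : ((k.+1 + d).+1 + k.+1 = (k.+1 + d + k).+2)%N by lia.
have -> : ((k.+1 + d) + k.+1 = (k.+1 + d + k).+1)%N by lia.
have -> : ((k.+1 + d).+1 + k = (k.+1 + d + k).+1)%N by lia.
rewrite (iqE R d) (iqE R (k.+1 + d + k).+1) (pentS k.+1).
have [q1 E] := qpowS.
have -> : (3 * k.+1 = k.+1 + k.+1 + k.+1)%N by lia.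
by rewrite !(addSn, addnS) !E !qpowD ?qpow0 !exprS; ring.
Qed.

(** The Bailey pair relative to 1 with $\beta_n = 1/(q)_n$. Both sides satisfy $(1-q^{n+1})x_{n+1} =
    x_n$: the top term of the sum for $n+1$ cancels the boundary term of [bailey_partial]. *)
Lemma unit_bailey_pair n : \sum_(r < n.+1) alpha r * iq (n - r) * iq (n + r) = iq n.
Proof.
elim: n => [|n IH]; first by rewrite big_ord1 /alpha /= iq0 !mulr1.
apply: (mulrI (unit_1Bq R (ltn0Sn n))); rewrite -iqE -IH.
apply/eqP; rewrite -subr_eq0; apply/eqP.
rewrite big_ord_recr /= mulrDr addrAC bailey_partial // alphaS !subnn iq0.
have -> : (n.+1 + n.+1 = (n.+1 + n).+1)%N by lia.
have E2 : qpow (n.+1 + n).+1 = qpow n.+1 * qpow n.+1 :> fps R by rewrite -qpowD addnS.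
by rewrite (iqE R (n.+1 + n)) E2 exprS qpow0; ring.
Qed.

(** For large $n$ the Bailey pair tends to $1/(q) = (q)^{-2}\sum_r \alpha_r$, which is the
    pentagonal number theorem. *)
Lemma euler_pentagonal_trunc N : ordge N (P - \sum_(r < N.+1) alpha r).
Proof.
set x := \sum_(r < _) _.
have o n r : (r <= n)%N -> ordge (n - r) (iq (n - r) * iq (n + r) - P^-1 ^+ 2 : fps R).
  move=> rn; have -> : iq (n - r) * iq (n + r) - P^-1 ^+ 2 =
     (iq (n - r) - P^-1) * iq (n + r) + P^-1 * (iq (n + r) - P^-1) by ring.
  by apply: ordgeD; [apply: ordgeMl|apply: ordgeMr];
    apply: ordgeW (iq_pinf _ _); lia.
have oa r : ordge r (alpha r).
  case: r => [|r]; first exact: ordge0.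
  rewrite alphaS; apply/ordgeMl/ordgeMr; apply: ordgeW (ordge_qpow _ _).
  by rewrite pentS; lia.
have : ordge N (iq N - P^-1 ^+ 2 * x).
  rewrite -unit_bailey_pair /x mulr_sumr -sumrB; apply: ordge_sum => r _.
  have -> : alpha r * iq (N - r) * iq (N + r) - P^-1 ^+ 2 * alpha r =
     alpha r * (iq (N - r) * iq (N + r) - P^-1 ^+ 2) by ring.
  have Hr := ltn_ord r; rewrite -{1}(@subnKC r N) //; apply: ordgeM => //.
  exact: o.
have -> : P - x = P ^+ 2 * ((iq N - P^-1 ^+ 2 * x) - (iq N - P^-1)).
  have u := mulrV (pinf_unit R).
  have -> : P ^+ 2 * (iq N - P^-1 ^+ 2 * x - (iq N - P^-1)) =
    P * (P / P) - (P / P) ^+ 2 * x by ring.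
  by rewrite u; ring.
move=> xo; apply/ordgeMr/ordgeB => //; apply: ordgeW (iq_pinf _ _); lia.
Qed.

(* The conjugate Bailey pair, as a telescoping sum. *)
Definition dterm r i : fps R := qp (r + i) ^+ 2 * qpow (r + i).+1 * iq i * iq (r.+1.*2 + i).
Definition delta r : fps R := gsum (dterm r).

Lemma ordge_dterm r i : ordge i (dterm r i).
Proof.
apply/ordgeMl/ordgeMl/ordgeMr; apply: ordgeW (ordge_qpow _ _); lia.
Qed.

(** The right-hand side has order above [M], so in the limit $q(1-q^{r+1})^2\delta_r =
    (1-q^{r+2})^2\delta_{r+1}$. *)
Lemma delta_partial r M :
  qpow 1 * (1 - qpow r.+1) ^+ 2 * (\sum_(i < M.+1) dterm r i)
  - (1 - qpow r.+2) ^+ 2 * (\sum_(i < M) dterm r.+1 i) =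
  (1 - qpow (r.+1.*2).+1) * qpow (r + M).+2 * qp (r + M).+1 ^+ 2 * iq M
    * iq (r.+1.*2 + M).+1.
Proof.
have [q1 E] := qpowS.
elim: M => [|M IH].
  rewrite big_ord1 big_ord0 /dterm !addn0 iq0 qpS (iqE R r.+1.*2).
  by rewrite !E ?qpow0; ring.
rewrite (big_ord_recr M.+1) [\sum_(i < M.+1) dterm r.+1 i]big_ord_recr /=.
rewrite [X in X - _]mulrDr [X in _ - X]mulrDr.
rewrite opprD addrACA IH /dterm (iqE R M).
have -> : (r.+2.*2 + M = (r.+1.*2 + M).+2)%N by lia.
rewrite !addnS addSn (iqE R (r.+1.*2 + M).+1) !qpS -!addnn.
by rewrite !(addSn, addnS) !E !qpowD ?qpow0; ring.
Qed.

Lemma delta0_partial M :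
  (1 - qpow 1) ^+ 2 * (\sum_(i < M) dterm 0 i) = 1 - (1 - qpow 1) * (1 - qpow M.+1)^-1.
Proof.
have [q1 E] := qpowS.
elim: M => [|M IH]; first by rewrite big_ord0 mulr0 divrr ?unit_1Bq // subrr.
have dE : dterm 0 M = qpow M.+1 * (1 - qpow M.+1)^-1 * (1 - qpow M.+2)^-1.
  have iE n : iq n.+1 = iq n * (1 - qpow n.+1)^-1 :> fps R.
    by rewrite (iqE R n) mulrAC divrr ?unit_1Bq // mul1r.
  rewrite /dterm !add0n doubleS double0 !addSn add0n !iE.
  transitivity ((qp M * iq M : fps R) ^+ 2 * (qpow M.+1 * (1 - qpow M.+1)^-1 * (1 - qpow M.+2)^-1)).
    by ring.
  by rewrite qpK expr1n mul1r.
rewrite big_ord_recr /= mulrDr IH dE.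
have u1 := divrr (unit_1Bq R (ltn0Sn M)); have u2 := divrr (unit_1Bq R (ltn0Sn M.+1)).
set v := (1 - qpow M.+1)^-1 in u1 *; set w := (1 - qpow M.+2)^-1 in u2 *.
have -> : (1 - qpow 1) ^+ 2 * (qpow M.+1 * v * w) =
   (1 - qpow 1) * (v * ((1 - qpow M.+2) * w) - w * ((1 - qpow M.+1) * v)).
  by rewrite !E qpow0; ring.
by rewrite u1 u2; ring.
Qed.

(** With $n = r+1+i$, [dterm r i] is $(q)_{n-1}^2 q^n / ((q)_{n-r-1}(q)_{n+r+1})$, so [delta r]
    belongs to the Bailey index $r+1$. The Bailey index 0 is treated apart and produces [lam] in
    [sum_bailey]. *)
Lemma deltaE r : (1 - qpow r.+1) ^+ 2 * delta r = qpow r.+1.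
Proof.
have st k M : ordge M (delta k - \sum_(i < M) dterm k i).
  by apply: gsum_trunc => i; apply: ordge_dterm.
elim: r => [|r IH].
  apply: ordge_eq => M; set S := \sum_(i < M) dterm 0 i.
  have u := divrr (unit_1Bq R (ltn0Sn M)).
  have -> : (1 - qpow 1) ^+ 2 * delta 0 - qpow 1 =
     (1 - qpow 1) ^+ 2 * (delta 0 - S) - (1 - qpow 1) * ((1 - qpow M.+1)^-1 - 1).
    by rewrite mulrBr delta0_partial; ring.
  apply: ordgeB; apply: ordgeMr; first exact: st.
  rewrite -[1 in X in _ - X]u -[X in X - _]mul1r -mulrBl; apply: ordgeMl.
  by rewrite opprB addrC subrK; apply: ordgeW (ordge_qpow _ _).
transitivity (qpow 1 * qpow r.+1 : fps R); last by rewrite -qpowD add1n.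
rewrite -IH; apply: ordge_eq => M; apply: ordgeW (leqnSn M) _.
set S := \sum_(i < M.+1) dterm r.+1 i; set T := \sum_(i < M.+2) dterm r i.
have -> : (1 - qpow r.+2) ^+ 2 * delta r.+1
      - qpow 1 * ((1 - qpow r.+1) ^+ 2 * delta r) =
  (1 - qpow r.+2) ^+ 2 * (delta r.+1 - S)
  - qpow 1 * (1 - qpow r.+1) ^+ 2 * (delta r - T)
  - (qpow 1 * (1 - qpow r.+1) ^+ 2 * T - (1 - qpow r.+2) ^+ 2 * S) by ring.
apply: ordgeB; last first.
  rewrite delta_partial; do 3 apply: ordgeMl; apply: ordgeMr.
  by apply: ordgeW (ordge_qpow _ _); lia.
by apply: ordgeB; apply: ordgeMr; [|apply: ordgeW (leqnSn _) _]; apply: st.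
Qed.

Lemma gsum_shift (F : nat -> fps R) k : (forall i, ordge i (F i)) ->
  gsum (fun n => if (k <= n)%N then F (n - k)%N else 0) = gsum F.
Proof.
move=> Fo; apply: fpsP => n.
rewrite (@coef_gsum _ _ F n (iota 0 n.+1)) ?iota_uniq //; last first.
  by move=> i; rewrite mem_iota add0n -leqNgt => ni; apply: (ordgeP _ _ (Fo i)).
rewrite (@coef_gsum _ _ _ n (iota 0 (k + n.+1))) ?iota_uniq //; last first.
  move=> i; rewrite mem_iota add0n -leqNgt => ni; rewrite ifT; last by lia.
  by apply: (ordgeP _ _ (Fo _)); lia.
rewrite iotaD big_cat big_seq big1 ?Monoid.mul1m => [|i]; last first.
  by rewrite mem_iota => /andP[_ ik]; rewrite ifN //; lia.
have -> : iota (0 + k) n.+1 = [seq (k + i)%N | i <- iota 0 n.+1].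
  by rewrite -iotaDl addn0.
rewrite big_map; apply: eq_bigr => i _.
by rewrite leq_addr addKn.
Qed.

Definition appell : fps R :=
  gsum (fun r => alpha r.+1 * (qpow r.+1 * (1 - qpow r.+1)^-1 ^+ 2)).

(** Insert the Bailey pair for $1/(q)_{n+1}$ and exchange the sums: the index 0 gives [lam], and
    every other index is summed over $n$ by [deltaE]. *)
Lemma sum_bailey :
  gsum (fun n => qp n ^+ 2 * qpow n.+1 * iq n.+1 : fps R) = lam R + appell.
Proof.
pose G r n : fps R := if (r <= n)%N then alpha r.+1 * dterm r (n - r) else 0.
have oa r : ordge r (alpha r).
  case: r => [|r]; first exact: ordge0.
  rewrite alphaS; apply/ordgeMl/ordgeMr; apply: ordgeW (ordge_qpow _ _).
  by rewrite pentS; lia.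
have E n : qp n ^+ 2 * qpow n.+1 * iq n.+1 =
    qpow n.+1 * (1 - qpow n.+1)^-1 ^+ 2 + gsum (G^~ n).
  rewrite -unit_bailey_pair big_ord_recl mulrDr; congr (_ + _).
    rewrite /alpha /= mul1r subn0 addn0.
    have iE : iq n.+1 = iq n * (1 - qpow n.+1)^-1 :> fps R.
      by rewrite (iqE R n) mulrAC divrr ?unit_1Bq // mul1r.
    rewrite iE.
    transitivity ((qp n * iq n : fps R) ^+ 2 * (qpow n.+1 * (1 - qpow n.+1)^-1 ^+ 2)); first by ring.
    by rewrite qpK expr1n mul1r.
  transitivity (\sum_(r <- iota 0 n.+1) G r n).
    rewrite -[iota _ _]/(index_iota 0 n.+1) big_mkord mulr_sumr.
    apply: eq_bigr => r _; have Hr := ltn_ord r; rewrite /G ifT; last by lia.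
    rewrite /dterm lift0 subSS (@subnKC r n) //.
    have -> : (r.+1.*2 + (n - r) = n.+1 + r.+1)%N by lia.
    by ring.
  apply: fpsP => m; rewrite coefs_sum (coef_gsum (iota_uniq 0 n.+1)) // => r.
  by rewrite mem_iota add0n -leqNgt => nr; rewrite /G ifN //; lia.
have sG : summable (fun a : nat * nat => G a.1 a.2).
  apply: usummable_summable => N.
  exists (allpairs pair (iota 0 N.+1) (iota 0 N.+1.*2)) => -[r n] rn; rewrite /G /=.
  case: leqP => rn'; last exact: ordge_0.
  apply: (@ordgeW _ N (r.+1 + (n - r))); last first.
    by apply: ordgeM; [exact: oa|exact: ordge_dterm].
  rewrite leqNgt; apply: contra rn => lt.
  by apply: allpairs_f; rewrite mem_iota; lia.
have s1 : summable (fun n => qpow n.+1 * (1 - qpow n.+1)^-1 ^+ 2 : fps R).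
  by apply: summable_nat => i; apply: ordgeMl; apply: ordgeW (ordge_qpow _ _).
rewrite (eq_gsum E) gsumD //; last first.
  apply: summable_nat => n; apply: ordge_gsum => r; rewrite /G.
  case: leqP => rn'; last exact: ordge_0.
  rewrite -(subnKC rn') addKn; apply: ordgeM (ordge_dterm _ _).
  by apply: ordgeW (oa r.+1).
congr (_ + _); rewrite (@gsum_exchange _ _ _ (fun n r => G r n)); last exact: (summable_swap sG).
apply: eq_gsum => r; rewrite /G.
rewrite (@gsum_shift (fun i => alpha r.+1 * dterm r i)) => [|i]; last first.
  by apply: ordgeMr (ordge_dterm _ _).
rewrite gsumMl; last by apply: summable_nat => i; apply: ordge_dterm.
congr (_ * _); have u := unit_1Bq R (ltn0Sn r).
by apply: (mulrI (unitrX 2 u)); rewrite deltaE exprVn mulrCA divrr ?unitrX // mulr1.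
Qed.
End Bailey.

(** * The generating function of spt *)

Section SptSeries.

(* The partitions of [n] with parts at most [k], sorted by the multiplicity [j]
   of the part [k]. *)
Fixpoint bparts (k n : nat) : seq (seq nat) :=
  if k is k'.+1 then
    flatten [seq [seq nseq j k ++ s | s <- bparts k' (n - j * k)]
            | j <- iota 0 (n %/ k).+1]
  else if n == 0%N then [:: [::]] else [::].

Lemma mem_bparts k n s :
  (s \in bparts k n) = is_partition n s && all (leq^~ k) s.
Proof.
elim: k n s => [|k IH] n s.
  rewrite /= /is_partition; case: s => [|x s] /=; first by case: n.
  case: eqP => _; rewrite ?inE; case: x => [|x] //=; rewrite ?andbF //.
apply/flattenP/idP => [[l /mapP[j]]|].
  rewrite mem_iota add0n ltnS /= => jn -> /mapP[t]; rewrite IH.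
  case/andP=> /and3P[st t1 /eqP sumt] tk ->.
  have jk : (j * k.+1 <= n)%N by rewrite -leq_divRL.
  rewrite /is_partition !all_cat sumn_cat sumn_nseq sumt mulnC subnKC // eqxx t1.
  rewrite !all_nseq leqnn !orbT /= !andbT.
  have tk1 : all (leq^~ k.+1) t by apply: sub_all tk => i /= /leqW.
  rewrite tk1 andbT; elim: {jn jk sumt} j => //= j.
  case: j => [|j] /= IHj; last by rewrite leqnn.
  by case: t st tk1 {t1 tk IHj} => //= y t -> /andP[-> _].
case/andP=> /and3P[ss s1 /eqP sums] sk.
pose j := count_mem k.+1 s.
have [t st tk] : exists2 t, s = nseq j k.+1 ++ t & all (leq^~ k) t.
  rewrite /j; elim: s ss sk {s1 sums j} => [|x s IHs] /=; first by exists [::].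
  rewrite (path_sortedE (rev_trans leq_trans)) => /andP[xs ss] /andP[xk sk].
  have [t e tk] := IHs ss sk; have [->|xk'] := eqVneq x k.+1.
    by exists t; rewrite ?add1n //= -e.
  exists (x :: s); last first.
    have xk2 : (x <= k)%N by lia.
    by rewrite /= xk2; apply: sub_all xs => i /= ix; apply: leq_trans ix xk2.
  suff -> : count_mem k.+1 s = 0%N by [].
  apply/eqP; rewrite -leqn0 leqNgt -has_count -all_predC.
  by apply: sub_all xs => i /= ix; apply/eqP => e'; lia.
have jk : (j * k.+1 <= n)%N.
  by rewrite -sums st sumn_cat sumn_nseq mulnC leq_addr.
exists [seq nseq j k.+1 ++ s | s <- bparts k (n - j * k.+1)].
  by apply/mapP; exists j; rewrite // mem_iota add0n ltnS leq_divRL.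
rewrite st; apply/map_f; rewrite IH tk andbT /is_partition.
move: ss s1 sums; rewrite st all_cat sumn_cat sumn_nseq => ss /andP[_ ->] <-.
rewrite mulnC addKn eqxx andbT.
by have [_ ->] := cat_sorted2 ss.
Qed.

Lemma uniq_bparts k n : uniq (bparts k n).
Proof.
elim: k n => [|k IH] n /=; first by case: eqP.
apply: (@allpairs_uniq_dep nat (fun=> seq nat) (seq nat)
  (fun j s => nseq j k.+1 ++ s) (iota 0 (n %/ k.+1).+1)
  (fun j => bparts k (n - j * k.+1))) => //; first exact: iota_uniq.
move=> u v /allpairsPdep[i [s [_ sk ->]]] /allpairsPdep[j [t [_ tk ->]]] /= e.
have c m r : r \in bparts k m -> count_mem k.+1 r = 0%N.
  rewrite mem_bparts => /andP[_ rk]; apply/eqP.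
  rewrite -leqn0 leqNgt -has_count -all_predC.
  by apply: sub_all rk => x /= xk; apply/eqP => e'; lia.
have ij : i = j.
  move/(congr1 (count_mem k.+1)): e; rewrite !count_cat (c _ _ sk) (c _ _ tk).
  by rewrite !count_nseq /= eqxx !mul1n !addn0.
rewrite ij in e *; move/(congr1 (drop j)): e.
by rewrite !drop_size_cat ?size_nseq // => ->.
Qed.

Definition bspt k n := (\sum_(s <- bparts k n) num_smallest_parts s)%N.

Lemma bspt_spt k n : (n <= k)%N -> bspt k n = spt n.
Proof.
move=> nk; rewrite /bspt /spt -(big_map (fun s : n.-bseq 'I_n.+1 => map val s)
  (is_partition n) num_smallest_parts) -[RHS]big_filter.
apply: perm_big; apply: uniq_perm; first exact: uniq_bparts.
  rewrite filter_uniq // map_inj_uniq ?index_enum_uniq //.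
  by move=> s t /(inj_map val_inj) /val_inj.
move=> s; rewrite mem_bparts mem_filter; apply: andb_id2l => ps.
have [t [<- _]] := partition_bseq ps; rewrite (map_f (fun s : n.-bseq 'I_n.+1 => map val s)) ?mem_index_enum //.
apply/allP => x /mapP[y _ ->]; apply: leq_trans nk; rewrite -ltnS; exact: ltn_ord.
Qed.

Lemma num_smallest_parts_cat j k s : all (leq^~ k) s ->
  num_smallest_parts (nseq j k.+1 ++ s) =
  (num_smallest_parts s + (s == [::]) * j)%N.
Proof.
rewrite /num_smallest_parts; case/lastP: s => [|s x] sk.
  have last_nseq x0 : last k.+1 (nseq x0 k.+1) = k.+1 by elim: x0.
  case: j => // j; have e : last 0 (nseq j.+1 k.+1) = k.+1 by exact: last_nseq.
  by rewrite cats0 e count_nseq /= eqxx !mul1n.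
have -> : (rcons s x == [::]) = false by case: (s).
rewrite mul0n addn0 -rcons_cat !last_rcons !rcons_cat count_cat.
have xk : (x <= k)%N by move/allP: sk; apply; rewrite mem_rcons mem_head.
by rewrite count_nseq /= -[_ == _]negbK; case: eqP => // e; lia.
Qed.

Lemma bsptS k n :
  bspt k.+1 n = (\sum_(j <- iota 0 (n %/ k.+1).+1)
    (bspt k (n - j * k.+1) + (n == j * k.+1)%N * j))%N.
Proof.
rewrite /bspt big_flatten big_map; apply: eq_big_seq => j.
rewrite mem_iota add0n ltnS leq_divRL // => /andP[_ jn].
have -> : (n == j * k.+1)%N = ([::] \in bparts k (n - j * k.+1)).
  by rewrite mem_bparts /is_partition /= andbT; lia.
rewrite big_map -count_uniq_mem ?uniq_bparts // -sum1_count big_distrl /= [X in (_ + X)%N]big_mkcond.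
rewrite -big_split /=; apply: eq_big_seq => s; rewrite mem_bparts => /andP[_ sk].
by rewrite num_smallest_parts_cat //; case: eqP; rewrite ?mul1n.
Qed.

Section Series.
Variable R : comNzRingType.

Definition bspt_series k : fps R := Fps (fun n => (bspt k n)%:R).
Definition spt_series : fps R := Fps (fun n => (spt n)%:R).

Lemma bspt_series0 : bspt_series 0 = 0.
Proof.
apply: fpsP => n; rewrite /= /bspt /=; case: eqP => _; first by rewrite big_seq1.
by rewrite big_nil.
Qed.

(** Removing the $j$ copies of the part $k+1$ does not affect the smallest parts unless nothing
    remains; then all $j$ copies count, which contributes $\sum_j j q^{j(k+1)} =
    q^{k+1}/(1-q^{k+1})^2$. *)
Lemma bspt_seriesS k : (1 - qpow k.+1) * bspt_series k.+1 =
  bspt_series k + qpow k.+1 * (1 - qpow k.+1)^-1.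
Proof.
have o j : ordge j (qpow (j * k.+1) : fps R).
  by apply: ordgeW (ordge_qpow _ _); rewrite leq_pmulr.
have s1 := summable_nat o.
have s2 : summable (fun j => qpow (j * k.+1) * j%:R : fps R).
  by apply: summable_nat => j; apply: ordgeMl.
have E : bspt_series k.+1 = gsum (fun j => qpow (j * k.+1)) * bspt_series k
     + gsum (fun j => qpow (j * k.+1) * j%:R).
  rewrite -gsumMr // -gsumD //; last first.
    by apply: summable_nat => j; apply: ordgeMl.
  apply: fpsP => n; rewrite (@coef_gsum _ _ _ n (iota 0 (n %/ k.+1).+1)) ?iota_uniq //.
    rewrite -[LHS]/((bspt k.+1 n)%:R) bsptS natr_sum; apply: eq_big_seq => j.
    rewrite mem_iota add0n ltnS leq_divRL // => /andP[_ jn].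
    rewrite coefsD !coef_qpowM jn natrD natrM /=; congr (_ + _).
    rewrite -[j%:R in RHS]mulr1 coefs_natM coefs1 mulrC; congr (_ * (nat_of_bool _)%:R).
    lia.
  move=> j; rewrite mem_iota add0n ltnS leq_divRL // -ltnNge => jn.
  by rewrite coefsD !coef_qpowM !ifN ?addr0 // -ltnNge.
have E2 : (1 - qpow k.+1) * gsum (fun j => qpow (j * k.+1) * j%:R) =
    qpow k.+1 * (1 - qpow k.+1)^-1 :> fps R.
  have -> : gsum (fun j => qpow (j * k.+1) * j%:R) =
     gsum (fun j => j.+1%:R * qpow (j * k.+1)) - gsum (fun j => qpow (j * k.+1)) :> fps R.
    rewrite -gsumB //; last by apply: summableMr.
    by apply: eq_gsum => j; rewrite -natr1; ring.
  apply: (mulrI (unit_1Bq R (ltn0Sn k))).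
  have g1 := geom_gsum R (ltn0Sn k); have g2 := geom2_gsum R (ltn0Sn k).
  rewrite [RHS]mulrCA divrr ?unit_1Bq // mulr1 mulrA -expr2 mulrBr g2 expr2 -mulrA g1.
  by ring.
by rewrite E mulrDr mulrA geom_gsum // mul1r E2.
Qed.

Lemma qp_bspt k : qp k * bspt_series k =
  \sum_(m < k) qp m ^+ 2 * qpow m.+1 * iq m.+1.
Proof.
elim: k => [|k IH]; first by rewrite bspt_series0 big_ord0 mulr0.
rewrite big_ord_recr /= -IH qpS -mulrA bspt_seriesS mulrDr; congr (_ + _).
have -> : iq k.+1 = iq k * (1 - qpow k.+1)^-1 :> fps R.
  by rewrite (iqE R k) mulrAC divrr ?unit_1Bq // mul1r.
transitivity (qp k * (qp k * iq k) * (qpow k.+1 * (1 - qpow k.+1)^-1) : fps R).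
  by rewrite qpK mulr1.
by ring.
Qed.

Theorem pinf_spt : pinf * spt_series = lam R + appell R.
Proof.
rewrite -sum_bailey; apply: gsum_limit => [i|N].
  by apply/ordgeMl/ordgeMr; apply: ordgeW (ordge_qpow _ _).
rewrite -qp_bspt.
have -> : pinf * spt_series - qp N * bspt_series N =
    (pinf - qp N) * spt_series + qp N * (spt_series - bspt_series N) by ring.
apply: ordgeD; [apply: ordgeMl|apply: ordgeMr].
  by rewrite -opprB; apply/ordgeN/(ordgeW (leqnSn N))/qp_pinf.
by apply/ordgeP => n nN; rewrite coefsB /= bspt_spt ?subrr // ltnW.
Qed.

End Series.
End SptSeries.

(** * Jacobi's identity *)

Section Jacobi.
Variable R : comNzRingType.
Implicit Types x y z : fps R.
Local Notation P := (@pinf R).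

Definition tri (r : nat) : nat := ((r * r.+1) %/ 2)%N.
Lemma triS r : tri r.+1 = (tri r + r.+1)%N.
Proof.
rewrite /tri; have -> : (r.+1 * r.+2 = r * r.+1 + r.+1 * 2)%N by nia.
by rewrite divnDMl.
Qed.

Let u n r : fps R := if (r <= n)%N then iq (n - r) * iq (n + r).+1 else 0.
Let a n r : fps R := (-1) ^+ r * qpow (tri r) * u n r.

Lemma uE1 n r : (r <= n.+1)%N ->
  u n r = (1 - qpow (n.+1 - r)) * (1 - qpow (n.+1 + r).+1) * u n.+1 r.
Proof.
rewrite /u => rn; rewrite rn; case: leqP => rn'; last first.
  have -> : r = n.+1 by lia.
  by rewrite subnn qpow0; ring.
rewrite subSn // (iqE R (n - r)) (iqE R (n + r).+1) addSn; ring.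
Qed.

Lemma uE2 n r : (r <= n)%N ->
  u n r.+1 = (1 - qpow (n - r)) * (1 - qpow (n.+1 - r)) * u n.+1 r.
Proof.
rewrite /u => rn; rewrite (leqW rn); case: ltnP => rn'; last first.
  have -> : r = n by lia.
  by rewrite subnn qpow0; ring.
rewrite subSn // (iqE R (n - r.+1)) (_ : (n - r.+1).+1 = n - r)%N; last by lia.
by rewrite (iqE R (n - r)) addSn addnS; ring.
Qed.

Lemma uE3 n r : (r <= n)%N ->
  u n r = (1 - qpow (n + r).+2) * (1 - qpow (n + r).+3) * u n.+1 r.+1.
Proof.
rewrite /u => rn; rewrite ltnS rn subSS (iqE R (n + r).+1) (iqE R (n + r).+2).
by rewrite addSn addnS; ring.
Qed.

(* Summation by parts of a discrete second derivative against [2 r + 1]. *)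
Lemma jacobi_partial n k : (k <= n)%N ->
  (1 - qpow n.+1.*2) * (1 - qpow n.+1.*2.+1) * (\sum_(r < k.+1) r.*2.+1%:R * a n.+1 r)
  - (1 - qpow n.+1) ^+ 2 * (\sum_(r < k.+1) r.*2.+1%:R * a n r) =
  qpow n.+1 * (k.*2.+3%:R * a n k - k.*2.+1%:R * a n k.+1).
Proof.
have [q1 E] := qpowS R.
elim: k => [_|k IH kn].
  rewrite !big_ord1 /= /a expr0 (uE2 (leq0n n)) (uE1 (leq0n n.+1)) !subn0 addn0 triS.
  have -> : tri 0 = 0%N by [].
  by rewrite double0 -!addnn !(addSn, addnS) ?add0n ?addn0 ?E ?qpowD ?E ?qpow0 expr1; ring.
rewrite !(big_ord_recr k.+1) /= [X in X - _]mulrDr [X in _ - X]mulrDr opprD addrACA.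
rewrite IH ?(ltnW kn) // /a (uE3 (ltnW kn)) (uE1 (leqW kn)) (uE2 kn).
set V := u n.+1 k.+1; rewrite !triS.
have -> : (n = k.+1 + (n - k.+1))%N by lia.
set d := (n - k.+1)%N.
have -> : ((k.+1 + d).+1 - k.+1 = d.+1)%N by lia.
have -> : (k.+1 + d - k.+1 = d)%N by lia.
have N m : m.*2.+1%:R = m%:R + m%:R + 1 :> fps R by rewrite -addnn -natr1 natrD.
have N3 m : m.*2.+3%:R = m%:R + m%:R + 1 + 1 + 1 :> fps R.
  by rewrite -addnn -!natr1 natrD.
rewrite !N !N3 -!natr1 -!addnn !(addSn, addnS) ?E ?qpowD ?E ?qpow0 !exprS; ring.
Qed.

(** In the limit the left side is $(q)^{-2}\sum_r (-1)^r(2r+1)q^{r(r+1)/2}$ and the right side is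
    $(q)$: a finite form of Jacobi's identity. *)
Lemma jacobi_finite n :
  \sum_(r < n.+1) r.*2.+1%:R * a n r = qp n ^+ 2 * iq n.*2.+1.
Proof.
elim: n => [|n IH].
  by rewrite big_ord1 /= /a /u /= (_ : tri 0 = 0%N) // subnn addn0 double0 iq0 qp0 qpow0; ring.
have cu : (1 - qpow n.+1.*2) * (1 - qpow n.+1.*2.+1) \is a @GRing.unit (fps R).
  by rewrite unitrM !unit_1Bq.
apply: (mulrI cu); rewrite big_ord_recr /= mulrDr.
have := jacobi_partial (leqnn n); rewrite IH => /(canRL (subrK _)) ->.
have iE : iq n.*2.+1 = (1 - qpow n.+1.*2) * ((1 - qpow n.+1.*2.+1) * iq n.+1.*2.+1) :> fps R.
  by rewrite (iqE R n.*2.+1) (iqE R n.*2.+2).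
rewrite /a /u ltnn !leqnn !subnn iq0 addnn [(n.+1 + n.+1)%N]addnn iE qpS triS qpowD.
have -> : n.+1.*2.+1 = n.*2.+3 by [].
rewrite exprS; ring.
Qed.

Lemma ordge_tri r : ordge r (qpow (tri r) : fps R).
Proof. by apply: ordgeW (ordge_qpow _ _); elim: r => // r IH; rewrite triS; lia. Qed.

Lemma jacobi_cube : P ^+ 3 = gsum (fun r => (-1) ^+ r * r.*2.+1%:R * qpow (tri r)).
Proof.
have o r : ordge r ((-1) ^+ r * r.*2.+1%:R * qpow (tri r) : fps R).
  by apply: ordgeMr; apply: ordge_tri.
apply: ordge_eq => N; set y := gsum _.
pose c r : fps R := (-1) ^+ r * r.*2.+1%:R * qpow (tri r).
pose x := \sum_(r < N.+1) c r.
have yx : ordge N (y - x) by apply: ordgeW (leqnSn N) _; apply: gsum_trunc.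
have u1 := divrr (pinf_unit R); set w := P^-1 in u1 *.
pose z : fps R := qp N ^+ 2 * iq N.*2.+1.
have zx : ordge N (z - w ^+ 2 * x).
  rewrite /z -jacobi_finite /x mulr_sumr -sumrB; apply: ordge_sum => r _.
  have Hr := ltn_ord r; have rN : (r <= N)%N by [].
  have -> : r.*2.+1%:R * a N r - w ^+ 2 * c r =
      c r * ((iq (N - r) - w) * iq (N + r).+1 + w * (iq (N + r).+1 - w)).
    by rewrite /a /u rN /c; ring.
  rewrite -{1}(subnKC rN); apply: ordgeM; first by apply: ordgeMr; apply: ordge_tri.
  by apply: ordgeD; [apply: ordgeMl|apply: ordgeMr];
    apply: ordgeW (iq_pinf _ _); lia.
have zP : ordge N (z - P ^+ 2 * w).
  have -> : z - P ^+ 2 * w = (qp N - P) * ((qp N + P) * iq N.*2.+1)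
    + P ^+ 2 * (iq N.*2.+1 - w) by rewrite /z; ring.
  apply: ordgeD; [apply: ordgeMl; apply: ordgeW (qp_pinf _ _)|
    apply: ordgeMr; apply: ordgeW (iq_pinf _ _)]; lia.
have -> : P ^+ 3 - y = P ^+ 2 * ((z - w ^+ 2 * x) - (z - P ^+ 2 * w)) - (y - x).
  have -> : P ^+ 2 * ((z - w ^+ 2 * x) - (z - P ^+ 2 * w)) - (y - x) =
    P ^+ 3 * (P * w) - (P * w) ^+ 2 * x - (y - x) by ring.
  by rewrite u1; ring.
by apply: ordgeB => //; apply/ordgeMr/ordgeB.
Qed.
End Jacobi.

(** * The rank recurrence *)

Section RankSums.
Variable R : comNzRingType.
Local Notation P := (@pinf R).

Lemma gsum_recl (F : nat -> fps R) : (forall i, ordge i (F i)) ->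
  gsum F = F 0%N + gsum (fun n => F n.+1).
Proof.
move=> Fo; have FS : forall i, ordge i (F i.+1) by move=> i; apply: ordgeW (Fo i.+1).
apply: fpsP => n; rewrite coefsD.
have cz i : i \notin iota 0 n.+1 -> coefs (F i) n = 0.
  by rewrite mem_iota add0n -leqNgt => ni; apply: (ordgeP _ _ (Fo i)).
rewrite (@coef_gsum _ _ F n (iota 0 n.+2)) ?iota_uniq //; last first.
  by move=> i; rewrite mem_iota add0n -leqNgt => ni; apply: (ordgeP _ _ (Fo i)); lia.
rewrite (@coef_gsum _ _ _ n (iota 0 n.+1)) ?iota_uniq //; last first.
  by move=> i; rewrite mem_iota add0n -leqNgt => ni; apply: (ordgeP _ _ (FS i)).
by rewrite -[iota 0 n.+2]/(0%N :: iota (1 + 0) n.+1) big_cons iotaDl big_map.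
Qed.

(** The exponent is $n(3n+1)/2 + mn$; replacing $n$ by $n+1$ turns $m$ into $m+3$, whence the step
    of the recurrence. *)
Definition rankB m : fps R := gsum (fun n => (-1) ^+ n * qpow (pent n + n + m * n)).
Lemma ordge_rankB m n : ordge n ((-1) ^+ n * qpow (pent n + n + m * n) : fps R).
Proof. by apply: ordgeMr; apply: ordgeW (ordge_qpow _ _); lia. Qed.
Lemma rankB_rec m : rankB m = 1 - qpow m.+2 * rankB m.+3.
Proof.
rewrite {1}/rankB gsum_recl; last exact: ordge_rankB.
rewrite -gsumMl; last by apply: summable_nat => i; apply: ordge_rankB.
rewrite muln0 -gsumN; last first.
  by apply: summableMr; apply: summable_nat => i; apply: ordge_rankB.
congr (_ + _); first by rewrite expr0 mul1r.
apply: eq_gsum => n; rewrite pentS exprS.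
have -> : (pent n + (3 * n).+1 + n.+1 + m * n.+1 = m.+2 + (pent n + n + m.+3 * n))%N by nia.
by rewrite qpowD; ring.
Qed.

(** Expand $(1+x)/(1-x)^2 = \sum_m (2m+1)x^m$ at $x = q^r$ and exchange the sums; the absent term $r
    = 0$ accounts for the subtracted 1. *)
Lemma appell_rankB : appell R = gsum (fun m => m.*2.+1%:R * (rankB m - 1)).
Proof.
pose F r m : fps R := m.*2.+1%:R * ((-1) ^+ r.+1 * qpow (pent r.+1 + r.+1 + m * r.+1)).
have o r : ordge r ((-1) ^+ r.+1 * qpow (pent r.+1) * qpow r.+1 : fps R).
  by apply: ordgeMr; apply: ordgeW (ordge_qpow _ _).
have og r m : ordge m (qpow (m * r.+1) : fps R).
  by apply: ordgeW (ordge_qpow _ _); rewrite leq_pmulr.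
have sF : summable (fun a : nat * nat => F a.1 a.2).
  apply: usummable_summable => N.
  exists (allpairs pair (iota 0 N) (iota 0 N)) => -[r m] rm; rewrite /F /=.
  apply/ordgeMr/ordgeMr; apply: (ordgeW _ (ordge_qpow _ _)).
  rewrite leqNgt; apply: contra rm => lt; apply: allpairs_f; rewrite mem_iota; nia.
have E r : alpha R r.+1 * (qpow r.+1 * (1 - qpow r.+1)^-1 ^+ 2) = gsum (F r).
  have -> : F r = fun m => ((-1) ^+ r.+1 * qpow (pent r.+1) * qpow r.+1) *
        (2%:R * (m.+1%:R * qpow (m * r.+1)) - qpow (m * r.+1)).
    apply/funext => m; rewrite /F !qpowD -addnn -natr1 natrD -natr1; ring.
  have s1 : summable (fun m => qpow (m * r.+1) : fps R) by apply: summable_nat => m.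
  rewrite gsumMl; last first.
    by apply: summableD; [do 2 apply: summableMr|apply: summableN].
  rewrite gsumB //; last by do 2 apply: summableMr.
  rewrite gsumMl; last exact: summableMr.
  have u := unit_1Bq R (ltn0Sn r).
  have g1 := geom_gsum R (ltn0Sn r); have g2 := geom2_gsum R (ltn0Sn r).
  have g1' : (1 - qpow r.+1) ^+ 2 * gsum (fun j => qpow (j * r.+1)) = 1 - qpow r.+1 :> fps R.
    by rewrite expr2 -mulrA g1 mulr1.
  apply: (mulrI (unitrX 2 u)); rewrite alphaS exprVn.
  transitivity ((-1) ^+ r.+1 * qpow (pent r.+1) * (1 + qpow r.+1) * qpow r.+1 *
     ((1 - qpow r.+1) ^+ 2 * ((1 - qpow r.+1) ^+ 2)^-1) : fps R); first by ring.
  rewrite divrr ?unitrX // mulrCA mulrBr [_ ^+ 2 * (2%:R * _)]mulrCA g2.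
  by rewrite g1'; ring.
rewrite /appell (eq_gsum E) gsum_exchange //; apply: eq_gsum => m.
rewrite /F gsumMl; last first.
  by apply: summable_nat => r; apply: ordgeW (ordge_rankB m r.+1).
congr (_ * _); rewrite [rankB m]gsum_recl; last exact: ordge_rankB.
by rewrite muln0 expr0 mul1r addrAC subrr add0r.
Qed.

Definition rankN m := rankB m * P^-1.
Definition rankA m := 3%:R * qD P^-1 + (tri m)%:R * P^-1.
Definition rankF m := 3%:R * qD (rankN m) + (tri m)%:R * rankN m.

Lemma rankN_rec m : rankN m = P^-1 - qpow m.+2 * rankN m.+3.
Proof. by rewrite /rankN rankB_rec; ring. Qed.

(** The coefficients 3 and $m(m+1)/2$ are matched: differentiating $q^{m+2}$ contributes $3(m+2)$,
    exactly the growth of the triangular number from $m$ to $m+3$. *)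
Lemma rankF_rec m : rankF m = rankA m - qpow m.+2 * rankF m.+3.
Proof.
rewrite /rankF /rankA rankN_rec raddfB /= qDM qD_qpow.
have -> : tri m.+3 = (tri m + 3 * m.+2)%N by rewrite !triS; lia.
by rewrite natrD natrM; ring.
Qed.

Lemma rec3_unique (f g A : nat -> fps R) :
  (forall m, f m = A m - qpow m.+2 * f m.+3) ->
  (forall m, g m = A m - qpow m.+2 * g m.+3) -> f =1 g.
Proof.
move=> Ef Eg m; apply: ordge_eq => N; elim: N m => [|N IH] m; first exact: ordge0.
have -> : f m - g m = - (qpow m.+2 * (f m.+3 - g m.+3)) by rewrite Ef Eg; ring.
apply: ordgeN; apply: (@ordgeW _ _ (m.+2 + N)); first by lia.
by apply: ordgeM => //; apply: ordge_qpow.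
Qed.

Lemma ordge_rankN m : ordge m (rankN m - P^-1).
Proof.
rewrite rankN_rec addrAC subrr add0r; apply/ordgeN/ordgeMl.
by apply: ordgeW (ordge_qpow _ _); lia.
Qed.

End RankSums.

(** * Reduction to a lattice sum *)

Section PartialTheta.
Variables (R : comNzRingType) (p : nat).
Hypothesis p_gt0 : (0 < p)%N.

Lemma in_qp0 : in_qp p (0 : fps R). Proof. exact/in_qpP. Qed.
Lemma in_qp1 : in_qp p (1 : fps R). Proof. by apply/in_qpP => -[|n] //; rewrite dvdn0. Qed.
Lemma in_qpN (x : fps R) : in_qp p x -> in_qp p (- x).
Proof. by move=> /in_qpP xp; apply/in_qpP => n /xp e; rewrite coefsN e oppr0. Qed.
Lemma in_qpD (x y : fps R) : in_qp p x -> in_qp p y -> in_qp p (x + y).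
Proof.
by move=> /in_qpP xp /in_qpP yp; apply/in_qpP => n pn; rewrite coefsD xp ?yp ?addr0.
Qed.
Lemma in_qpM (x y : fps R) : in_qp p x -> in_qp p y -> in_qp p (x * y).
Proof.
move=> /in_qpP xp /in_qpP yp; apply/in_qpP => n pn; rewrite coefsM big1 // => i _.
have [pi|/xp->] := boolP (p %| i)%N; last by rewrite mul0r.
rewrite yp ?mulr0 //; apply: contra pn => pni.
have Hi := ltn_ord i; by rewrite -(@subnKC i n) ?dvdn_add //.
Qed.
Lemma in_qpX (x : fps R) n : in_qp p x -> in_qp p (x ^+ n).
Proof. by move=> xp; elim: n => [|n IH]; [apply: in_qp1|rewrite exprS; apply: in_qpM]. Qed.
Lemma in_qp_int (m : int) : in_qp p (m%:~R : fps R).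
Proof.
have nat n : in_qp p (n%:R : fps R).
  by elim: n => [|n IH]; [apply: in_qp0|rewrite -natr1; apply: in_qpD in_qp1].
by case: m => m; [exact: nat|rewrite NegzE mulrNz; apply/in_qpN/nat].
Qed.
Lemma in_qp_gsum (I : choiceType) (F : I -> fps R) :
  (forall i, in_qp p (F i)) -> in_qp p (gsum F).
Proof.
move=> Fp; apply/in_qpP => n pn; rewrite (@coef_gsum _ _ _ _ [::]) ?big_nil // => i _.
exact: (in_qpP _ _ (Fp i)).
Qed.

(** The coefficient of $z^{pj}$ in the partial fraction $\sum_n (-1)^n q^{pn(n+1)/2}/(1-z^pq^{pn})$
    of an inverse theta function in $q^p$, for $|q| < |z| < 1$. Negative powers of $z^p$ lead to
    [pthz]. *)
Definition pth (j : nat) : fps R :=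
  gsum (fun n => (-1) ^+ n * qpow (p * (tri n + n * j))).
Lemma ordge_pth j n : ordge n ((-1) ^+ n * qpow (p * (tri n + n * j)) : fps R).
Proof.
apply: ordgeMr; apply: ordgeW (ordge_qpow _ _).
apply: leq_trans (leq_pmull _ p_gt0); apply: leq_trans (leq_addr _ _).
by elim: n => // n IH; rewrite triS; lia.
Qed.
Lemma pth_rec j : pth j = 1 - qpow (p * j.+1) * pth j.+1.
Proof.
rewrite {1}/pth gsum_recl; last exact: ordge_pth.
rewrite -gsumMl; last by apply: summable_nat => i; apply: ordge_pth.
rewrite -gsumN; last first.
  by apply: summableMr; apply: summable_nat => i; apply: ordge_pth.
congr (_ + _); first by rewrite muln0 expr0 mul1r.
apply: eq_gsum => n; rewrite triS exprS.
have -> : (p * (tri n + n.+1 + n.+1 * j) = p * j.+1 + p * (tri n + n * j.+1))%N by nia.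
by rewrite qpowD; ring.
Qed.

(* Extended to all indices by [pthz (-1 - j) = 1 - pthz j]. *)
Definition pthz (j : int) : fps R :=
  match j with Posz j => pth j | Negz j => 1 - pth j end.
Lemma pthz_in_qp j : in_qp p (pthz j).
Proof.
have pthp i : in_qp p (pth i).
  apply: in_qp_gsum => n; apply: in_qpM; last by apply/in_qp_qpow/dvdn_mulr.
  by apply/in_qpX/in_qpN/in_qp1.
by case: j => j /=; [|apply: in_qpD; [apply: in_qp1|apply: in_qpN]]; apply: pthp.
Qed.

Lemma pthz_pos (j : nat) : qpow (p * j) * pthz j%:Z = 1 - pthz (j%:Z - 1).
Proof.
case: j => [|j]; first by rewrite muln0 qpow0 mul1r sub0r /= opprB addrC subrK.
by rewrite -addn1 PoszD addrK /= addn1 (pth_rec j); ring.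
Qed.
Lemma pthz_neg (j : nat) : pthz (- j%:Z) = qpow (p * j) * (1 - pthz (- j%:Z - 1)).
Proof.
have -> : - j%:Z - 1 = Negz j by rewrite NegzE; lia.
have -> : 1 - pthz (Negz j) = pth j by rewrite /=; ring.
case: j => [|j]; first by rewrite oppr0 muln0 qpow0 mul1r.
by rewrite -NegzE /= (pth_rec j); ring.
Qed.

(* [pthz] minus its limits, 1 at +oo and 0 at -oo. *)
Definition pthe (j : int) : fps R := pthz j - ((0 <= j)%R%:R : fps R).
Lemma pthe_opp j : pthe (-1 - j) = - pthe j.
Proof.
rewrite /pthe; case: j => j.
  have -> : -1 - j%:Z = Negz j by rewrite NegzE; lia.
  by rewrite /= mulr0n mulr1n; ring.
have -> : -1 - Negz j = j%:Z by rewrite NegzE; lia.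
by rewrite /= mulr0n mulr1n; ring.
Qed.
Lemma summable_pthe : summable pthe.
Proof.
have o i : ordge i (pth i - 1).
  rewrite pth_rec addrAC subrr add0r; apply/ordgeN/ordgeMl.
  by apply: ordgeW (ordge_qpow _ _); rewrite mulnS -[i in (i <= _)%N]mul1n; nia.
apply: usummable_summable => N.
exists ([seq i%:Z | i <- iota 0 N] ++ [seq Negz i | i <- iota 0 N]) => -[] j;
  rewrite mem_cat negb_or => /andP[j1 j2]; rewrite /pthe /=.
  rewrite mulr1n; apply: ordgeW (o j); rewrite leqNgt; apply: contra j1 => jN.
  by apply: map_f; rewrite mem_iota.
rewrite mulr0n subr0 -opprB; apply: ordgeN; apply: ordgeW (o j).
rewrite leqNgt; apply: contra j2 => jN; by apply: map_f; rewrite mem_iota.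
Qed.
End PartialTheta.

Lemma gsum_fiber (R : comNzRingType) (K M : choiceType) (mu : K -> M) (U : K -> fps R) :
  summable U -> gsum (fun m => gsum (fun x => if mu x == m then U x else 0)) = gsum U.
Proof.
move=> sU; rewrite gsum_exchange; last first.
  move=> n; have [s sU'] := sU n; exists [seq (mu x, x) | x <- s] => -[m x] /=.
  case: eqP => // <- xs; apply: sU'; apply: contra xs => xs.
  by apply/mapP; exists x.
apply: eq_gsum => x; rewrite (@gsum1 _ _ _ (mu x)) ?eqxx // => m.
by rewrite eq_sym => /negbTE ->.
Qed.

Lemma sum_antisym (R : comNzRingType) (I : choiceType) (F : I -> fps R) (f : I -> I) :
  bijective f -> summable F -> (forall i, F (f i) = - F i) -> 2%:R * gsum F = 0.
Proof.
move=> fb sF Ff; rewrite mulr_natl mulr2n {1}(gsum_reindex F fb).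
rewrite (eq_gsum (G := fun i => - F i)); first by rewrite gsumN // addNr.
by move=> i; rewrite /= Ff.
Qed.

(** * The lattice sum and its vanishing, for a general prime *)

Section LatticeSums.
Variables (R : comNzRingType) (p k : nat).
Local Notation P := (@pinf R).
Hypotheses (pk : p = k.+3) (p_prime : prime p) (p_odd : odd p) (p0 : p%:R = 0 :> fps R).
Variable n0 : nat.
Hypothesis n0p : (24 * n0 = 1 %[mod p])%N.
Local Notation pr := (pr p n0).

(** In the applications [I] is the lattice of dimension $k = p-3$, [T] is a product of $k$ theta
    terms over a power of $(q)$, [s] is 1 plus the sum of the coordinates, [sh] adds 1 to each
    coordinate and [inv] sends each $a$ to $1-a$. *)
Variables (I : choiceType) (T : I -> fps R) (s : I -> int) (sh inv : I -> I).
Hypotheses (sT : summable T) (sh_bij : bijective sh) (inv_inv : involutive inv).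
Hypothesis s_sh : forall a, s (sh a) = s a + k%:Z.
Hypothesis T_sh : forall a (u v : nat),
  u%:Z - v%:Z = s a - 1 -> qpow u * T a = qpow v * T (sh a).
Hypothesis s_inv : forall a, s (inv a) = p%:Z - 1 - s a.
Hypothesis T_inv : forall a, T (inv a) = T a.
Hypothesis T_class : forall m : nat,
  gsum (fun a => if (p%:Z %| m%:Z - s a)%Z then T a else 0) = rankA R m.
Hypothesis pr_pinfV : pr (P^-1) = 0.

Let p_gt0 : (0 < p)%N. Proof. exact: prime_gt0. Qed.

Lemma two_reg x : 2%:R * x = 0 :> fps R -> x = 0.
Proof.
move=> x2; have e : p%:R = 2%:R * (p./2)%:R + 1 :> fps R.
  by rewrite -{1}(odd_double_half p) p_odd natrD addrC -mul2n natrM.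
have : p%:R * x = 0 by rewrite p0 mul0r.
by rewrite e mulrDl mul1r mulrAC x2 mul0r add0r.
Qed.

Lemma intr_modp (a b : int) : (a = b %[mod p])%Z -> a%:~R = b%:~R :> fps R.
Proof.
move/eqP; rewrite eqz_mod_dvd => /dvdzP[c e].
by apply/eqP; rewrite -subr_eq0 -intrB e intrM /= -[p%:~R]/(p%:R) p0 mulr0.
Qed.

Lemma summable_index (x : int -> fps R) (m : int) :
  summable (fun a : I * int => if s a.1 + p%:Z * a.2 == m then x a.2 * T a.1 else 0).
Proof.
apply: usummable_summable => N; have [t tT] := summable_usummable sT N.
exists [seq (a, (m - s a) %/ p)%Z | a <- t] => -[a j] aj /=.
case: eqP => [e|_]; last exact: ordge_0.
apply/ordgeMr/tT; apply: contra aj => at'; apply/mapP; exists a => //.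
by congr (_, _); rewrite -e addrC addKr mulrC mulzK //; lia.
Qed.

Lemma gsum_index (F : I -> fps R) (m : int) : summable F ->
  summable (fun a : I * int => if s a.1 + p%:Z * a.2 == m then F a.1 else 0) ->
  gsum (fun a : I * int => if s a.1 + p%:Z * a.2 == m then F a.1 else 0) =
  gsum (fun a => if (p%:Z %| m - s a)%Z then F a else 0).
Proof.
move=> sF sF2; rewrite -(@gsum_pair _ _ _ (fun a j => if s a + p%:Z * j == m then F a else 0)) //.
apply: eq_gsum => a; case: dvdzP => [[j e]|ne].
  rewrite (@gsum1 _ _ _ j) => [|i ij].
    by rewrite ifT //; apply/eqP; rewrite mulrC -e; ring.
  by rewrite ifN //; apply: contra ij => /eqP e'; apply/eqP; nia.
apply: gsum_eq0 => j; case: eqP => // e; case: ne; exists j.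
by rewrite -e; ring.
Qed.

(** The coefficient of $z^m$ in the product of the theta series, graded by [s], with the inverse
    theta function in $z^p$. *)
Definition latC m : fps R :=
  gsum (fun a : I * int => if s a.1 + p%:Z * a.2 == m%:Z then pthz R p a.2 * T a.1 else 0).

(** Passing from $(a,j)$ to the shifted point and $j-1$ changes the index by $k-p = -3$. On the
    index $m+3$ one has $q^{m+2} = q^{s(a)-1}q^{pj}$: the first factor shifts [T], the second turns
    [pthz j] into [1 - pthz (j - 1)], and the 1 sums to [rankA]. *)
Lemma latC_rec m : latC m = rankA R m - qpow m.+2 * latC m.+3.
Proof.
have sA := summable_index (fun=> 1) m.
have EA : rankA R m =
    gsum (fun a : I * int => if s a.1 + p%:Z * a.2 == m then 1 * T a.1 else 0).
  rewrite -T_class -gsum_index //.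
    by apply: eq_gsum => a; rewrite mul1r.
  by apply: eq_summable sA => a; rewrite mul1r.
rewrite EA -gsumMl; last exact: summable_index.
pose f (a : I * int) := (sh a.1, a.2 - 1).
have fb : bijective f.
  have [g shK gK] := sh_bij; exists (fun a => (g a.1, a.2 + 1)) => -[a j] /=.
    by rewrite /f /= shK subrK.
  by rewrite /f /= gK addrK.
rewrite /latC (gsum_reindex _ fb) [in RHS](gsum_reindex _ fb).
rewrite -gsumB; last 2 first.
- exact: (summable_reindex fb sA).
- by apply: summableMr; apply: summable_index.
apply: eq_gsum => -[a j] /=; rewrite s_sh.
have -> : (s a + k%:Z + p%:Z * (j - 1) == m) = (s a + p%:Z * j == m.+3).
  by rewrite pk; apply/eqP/eqP; lia.
case: eqP => [e|_]; last by rewrite mulr0 subr0.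
suff E : qpow m.+2 * (pthz R p j * T a) = (1 - pthz R p (j - 1)) * T (sh a).
  by rewrite E; ring.
(* For negative $j$ the factor $q^{pj}$ has to be moved to the other side, since exponents are
   natural numbers. *)
case: j e => j e.
  have Te : qpow m.+2 * T a = qpow (p * j) * T (sh a) by apply: T_sh; lia.
  transitivity (pthz R p j * (qpow m.+2 * T a)); first by ring.
  by rewrite Te -(pthz_pos R p_gt0); ring.
have Te : qpow (m.+2 + p * j.+1) * T a = qpow 0 * T (sh a).
  by apply: T_sh; move: e; rewrite NegzE; lia.
move: Te; rewrite qpow0 mul1r => <-.
by rewrite NegzE (pthz_neg R p_gt0) qpowD; ring.
Qed.

Lemma rankF_latC : rankF R =1 latC.
Proof. exact: rec3_unique (rankF_rec R) latC_rec. Qed.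

Definition odd_wt (x : int) : fps R := (2%:Z * x + 1)%:~R.
Local Notation v := odd_wt.
Local Notation t a := (pr (T a)).

Lemma odd_wtX x : v x ^+ p = v x.
Proof.
have ch : p \in [pchar fps R] by rewrite inE p_prime p0 eqxx.
by rewrite -(pFrobenius_autE ch) rmorph_int.
Qed.

(** In degree $n$ the factor on the left is $24n + 4m(m+1)$, and $24n = 1$ on these exponents. *)
Lemma pr_rankF m : 8%:R * pr (rankF R m) = v m ^+ 2 * pr (rankN R m).
Proof.
apply: fpsP => n; rewrite coefs_natM coef_pr.
have -> : v m ^+ 2 = ((2 * m + 1) ^ 2)%:R :> fps R.
  by rewrite /odd_wt natrX; congr (_ ^+ 2); rewrite -[in RHS]pmulrn; congr (_%:~R); lia.
rewrite coefs_natM coef_pr; case: eqP => [e|_]; last by rewrite !mulr0.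
have pR : p%:R = 0 :> R.
  by have /(congr1 (fun x => coefs x 0)) := p0; rewrite -[p%:R]mulr1 coefs_natM coefs1 mulr1.
have n24 : 24%:R * n%:R = 1 :> R.
  rewrite -natrM (divn_eq (24 * n) p) natrD natrM pR mulr0 add0r -modnMmr e modnMmr n0p.
  by rewrite modn_small ?prime_gt1.
rewrite /rankF coefsD !coefs_natM coef_qD.
set x := coefs _ n; have t8 : 8%:R * (tri m)%:R = 4%:R * (m%:R * m%:R + m%:R) :> R.
  rewrite -natrM -(natrM _ m) -natrD -natrM; congr (_%:R).
  by elim: (m) => // i IH; rewrite triS; nia.
transitivity (24%:R * n%:R * x + 8%:R * (tri m)%:R * x); first by ring.
by rewrite n24 t8 natrX natrD natrM; ring.
Qed.

Lemma pr_qD (x : fps R) : pr (qD x) = qD (pr x).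
Proof. by apply: fpsP => n; rewrite coef_qD !coef_pr; case: eqP; rewrite ?mulr0. Qed.

Lemma pr_rankA m : pr (rankA R m) = 0.
Proof.
rewrite raddfD /= !pr_in_qpM ?pr_qD ?pr_pinfV ?raddf0 ?mulr0 ?addr0 //.
  exact: (@in_qp_int R p (Posz (tri m))).
exact: (@in_qp_int R p 3%:Z).
Qed.


Lemma pr_appell : pr (appell R * P^-1) =
  8%:R * gsum (fun m : nat => v m ^+ (p - 2) * pr (latC m)).
Proof.
have sN : summable (fun m => rankN R m - P^-1).
  by apply: summable_nat => m; apply: ordge_rankN.
have sF : summable (fun m : nat => v m ^+ (p - 2) * pr (latC m)).
  apply: summableMr; apply: summable_nat => m; rewrite -rankF_latC.
  rewrite -[rankF R m](subrK (rankA R m)) raddfD /= pr_rankA addr0.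
  apply/ordgeP => n nm; rewrite coef_pr (ordgeP m _ _) ?if_same //.
  have -> : rankF R m - rankA R m =
      3%:R * qD (rankN R m - P^-1) + (tri m)%:R * (rankN R m - P^-1).
    by rewrite /rankF /rankA raddfB /=; ring.
  by apply: ordgeD; apply: ordgeMr; [apply: ordge_qD|]; apply: ordge_rankN.
have sB : summable (fun m => m.*2.+1%:R * (rankB R m - 1)).
  apply: summableMr; apply: summable_nat => m; rewrite rankB_rec addrAC subrr add0r.
  by apply/ordgeN/ordgeMl; apply: ordgeW (ordge_qpow _ _); lia.
rewrite appell_rankB -gsumMr // gsum_pr; last first.
  by apply: eq_summable (summableMr (fun=> P^-1) sB) => m; rewrite mulrC.
rewrite -gsumMl //; apply: eq_gsum => m.
have vE : m.*2.+1%:R = v m :> fps R.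
  by rewrite /v pmulrn; congr (_%:~R); lia.
have -> : m.*2.+1%:R * (rankB R m - 1) * P^-1 = v m * (rankN R m - P^-1).
  by rewrite vE /rankN; ring.
have iv : in_qp p (v m) by apply: in_qp_int.
rewrite !pr_in_qpM // raddfB /= pr_pinfV subr0.
rewrite mulrCA -rankF_latC pr_rankF mulrA -exprD subnK ?odd_wtX ?expr1 //.
exact: prime_gt1.
Qed.

Lemma summable_if (J : choiceType) (F : J -> fps R) (b : pred J) :
  summable F -> summable (fun j => if b j then F j else 0).
Proof. by move=> Fs n; have [l lF] := Fs n; exists l => i /lF; case: ifP. Qed.

Let st : summable (fun a => t a). Proof. exact: summable_pr. Qed.

Lemma class_sum (m : nat) : gsum (fun a => if (p%:Z %| m%:Z - s a)%Z then t a else 0) = 0.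
Proof.
transitivity (pr (rankA R m)); last exact: pr_rankA.
rewrite -T_class gsum_pr; last exact: summable_if.
by apply: eq_gsum => a /=; case: ifP => // _; rewrite raddf0.
Qed.

Lemma gsum_big (J : choiceType) (n : nat) (F : nat -> J -> fps R) :
  (forall i, summable (F i)) ->
  summable (fun j => \sum_(i < n) F i j) /\
  gsum (fun j => \sum_(i < n) F i j) = \sum_(i < n) gsum (F i).
Proof.
move=> sF; elim: n => [|n [IH1 IH2]].
  rewrite big_ord0 gsum_eq0 => [|j]; last by rewrite big_ord0.
  by split=> // m; exists [::] => j _; rewrite big_ord0.
have E : (fun j => \sum_(i < n.+1) F i j) = (fun j => \sum_(i < n) F i j + F n j).
  by apply/funext => j; rewrite big_ord_recr.
by rewrite big_ord_recr /= E -IH2 gsumD //; split=> //; apply: summableD.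
Qed.

(** The weight is constant on each residue class of [s a], and the class sums vanish. *)
Lemma gsum_periodic (g : int -> fps R) : (forall x, g (x + p%:Z) = g x) ->
  gsum (fun a => g (s a) * t a) = 0.
Proof.
move=> gp; have gN x (n : nat) : g (x + n%:Z * p%:Z) = g x.
  elim: n x => [|n IH] x; first by rewrite mul0r addr0.
  by rewrite -addn1 PoszD mulrDl mul1r addrA gp IH.
have gE x y : (p%:Z %| x - y)%Z -> g x = g y.
  move/dvdzP=> [[] c e].
    by have -> : x = y + c%:Z * p%:Z by lia.
  by have -> : y = x + c.+1%:Z * p%:Z by move: e; rewrite NegzE; lia.
pose F r a := if (p%:Z %| r%:Z - s a)%Z then g r%:Z * t a else 0.
have sF r : summable (F r) by apply: summable_if; apply: summableMr.
have -> : (fun a => g (s a) * t a) = (fun a => \sum_(r < p) F r a).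
  apply/funext => a; have p0' : p%:Z != 0 by lia.
  have r0 := modz_ge0 (s a) p0'; have rp := ltz_pmod (s a) (p_gt0 : 0 < p%:Z).
  have rp' : (`|(s a %% p)%Z| < p)%N by lia.
  have e : (s a = (s a %/ p)%Z * p%:Z + (s a %% p)%Z) := divz_eq _ _.
  rewrite (bigD1 (Ordinal rp')) //= big1 => [|i /eqP ir].
    rewrite addr0 /F ifT; last first.
      by apply/dvdzP; exists (- (s a %/ p)%Z); rewrite gez0_abs //; lia.
    by congr (_ * _); apply: gE; apply/dvdzP; exists (s a %/ p)%Z; rewrite gez0_abs //; lia.
  rewrite /F ifN //; apply/negP => d; apply: ir; apply: val_inj => /=.
  have di : (i%:Z == s a %[mod p])%Z by rewrite eqz_mod_dvd.
  have Hi := ltn_ord i; move/eqP: di; rewrite modz_small ?ltz_nat ?Hi // => <-.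
  by [].
have [_ ->] := gsum_big p sF; rewrite big1 // => r _; rewrite /F.
have -> : (fun a => if (p%:Z %| r%:Z - s a)%Z then g r%:Z * t a else 0) =
   (fun a => g r%:Z * (if (p%:Z %| r%:Z - s a)%Z then t a else 0)).
  by apply/funext => a; case: ifP; rewrite ?mulr0.
by rewrite gsumMl ?class_sum ?mulr0 //; apply: summable_if.
Qed.

Let w a : fps R := v (s a) ^+ (p - 2) * t a.
Let sw : summable w. Proof. exact: summableMr. Qed.
Let z (a : I * int) : int := s a.1 + p%:Z * a.2.
(** A reflection exchanging the half-space [0 <= z] with its complement; [w] changes sign under it
    because $p-2$ is odd. *)
Let Phi (a : I * int) := (inv a.1, -1 - a.2).

Let Phi_bij : bijective Phi.
Proof.
exists Phi => -[a j]; rewrite /Phi /= inv_inv; congr (_, _); lia.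
Qed.

Let z_Phi a : z (Phi a) = -1 - z a.
Proof. by rewrite /z /= s_inv; lia. Qed.

Let w_Phi a : w (inv a) = - w a.
Proof.
rewrite /w T_inv s_inv.
have -> : v (p%:Z - 1 - s a) = - v (s a).
  rewrite /v -mulrNz; apply: intr_modp; apply/eqP; rewrite eqz_mod_dvd.
  by apply/dvdzP; exists 2%:Z; lia.
rewrite exprNn -signr_odd; have -> : odd (p - 2) by move: p_odd; rewrite oddB ?prime_gt1 //= addbF.
by rewrite expr1 mulN1r mulNr.
Qed.

(** Signed indicator of the difference between the half-lines $x+pj \ge 0$ and $j \ge 0$; its sum
    [y x] over $j$ is $\lfloor x/p \rfloor$. *)
Let chi (x j : int) : int :=
  (if (0 <= x + p%:Z * j) && (j < 0) then 1 else 0)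
  - (if (x + p%:Z * j < 0) && (0 <= j) then 1 else 0).

Let summable_chi x : summable (fun j => (chi x j)%:~R : fps R).
Proof.
move=> n; exists ([seq i%:Z | i <- iota 0 `|x|.+1] ++ [seq - i%:Z | i <- iota 0 `|x|.+1]).
move=> j; rewrite mem_cat negb_or => /andP[j1 j2].
suff -> : chi x j = 0 by rewrite coefs0.
have jx : (`|x| < `|j|)%N.
  rewrite ltnNge; apply/negP => jx; case/negP: j1.
  have [e|e] : j = `|j|%N%:Z \/ j = - `|j|%N%:Z by lia.
    by rewrite e map_f // mem_iota.
  by case/negP: j2; apply/mapP; exists `|j|%N; rewrite ?mem_iota.
have : (1 <= p)%N by []; rewrite /chi => p1.
case: ifP => [/andP[a b]|_]; first by nia.
by case: ifP => [/andP[a b]|_] //; nia.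
Qed.

Let y x : fps R := gsum (fun j => (chi x j)%:~R).

Let y_shift x : y (x + p%:Z) = y x + 1.
Proof.
have bj : bijective (fun j : int => j - 1) by exists (fun j => j + 1) => j; lia.
have -> : 1 = gsum (fun j : int => ((j == 0)%:R : fps R)).
  by rewrite (@gsum1 _ _ _ 0) // => j /negbTE ->.
rewrite /y (gsum_reindex _ bj) -gsumD //; last first.
  by move=> n; exists [:: 0] => j; rewrite inE => /negbTE ->.
apply: eq_gsum => j /=; rewrite -[(j == 0)%:R]/(((j == 0)%:Z)%:~R) -rmorphD /=.
congr (_%:~R); rewrite /chi.
have -> : x + p%:Z + p%:Z * (j - 1) = x + p%:Z * j by ring.
move: (x + p%:Z * j) => u.
case: ifP => ?; case: ifP => ?; case: ifP => ?; case: ifP => ?; lia.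
Qed.

(** Subtracting the vanishing class sums replaces [pthz j], which tends to 1, by [pthz j - 1]; only
    then can the sums over $m$ be merged into one over the half-space [0 <= z]. As [pthz j - 1] is
    [pthe j] minus the indicator of [j < 0], the result is [U1 - U2]. *)
Theorem pr_appell_eq0 (phi : int -> int) :
  (forall x, phi (x + p%:Z) = phi x + 2 %[mod p])%Z ->
  gsum (fun a => v (s a) ^+ (p - 2) * (phi (s a))%:~R * t a) = 0 ->
  pr (appell R * P^-1) = 0.
Proof.
move=> phi_shift phi0.
pose U1 a : fps R := if 0 <= z a then pthe R p a.2 * w a.1 else 0.
pose U2 a : fps R := if (0 <= z a) && (a.2 < 0) then w a.1 else 0.
have sE : summable (fun a : I * int => pthe R p a.2 * w a.1).
  apply: eq_summable (summable_pairMM sw (summable_pthe R p_gt0)) => a.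
  by rewrite mulrC.
have sU1 : summable U1 by apply: summable_if.
have sC : summable (fun a : I * int => (chi (s a.1) a.2)%:~R * w a.1).
  apply: usummable_summable => N; have [l lw] := summable_usummable sw N.
  have [f fP] := choice (fun a => summable_chi (s a) 0).
  exists (flatten [seq [seq (a, j) | j <- f a] | a <- l]) => -[a j] aj /=.
  have [al|/lw] := boolP (a \in l); last exact: ordgeMr.
  have jf : j \notin f a.
    by apply: contra aj => jf; apply/flattenP; exists [seq (a, i) | i <- f a];
      apply/mapP; [exists a|exists j].
  have c0 : (chi (s a) j)%:~R = 0 :> R.
    by have := fP a j jf; rewrite -[_%:~R]mulr1 coefs_intM coefs1 eqxx mulr1.
  apply: ordgeMl; apply/ordgeP => n _.
  by rewrite -[_%:~R]mulr1 coefs_intM c0 mul0r.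
have sU2 : summable U2.
  apply: eq_summable (summable_if (fun a : I * int => (0 <= z a) && (a.2 < 0)) sC) => a.
  rewrite /U2 /chi -/(z a); case: ifP => // /andP[z0 a0].
  have -> : (z a < 0) && (0 <= a.2) = false by lia.
  by rewrite subr0 z0 a0 mulr1z mul1r.
(* Both [pthe] and [w] change sign under [Phi], so twice the half-space sum is the full sum, which
   is odd under $j \mapsto -1-j$. *)
have U1_0 : gsum U1 = 0.
  apply: two_reg.
  have -> : 2%:R * gsum U1 = gsum (fun a : I * int => pthe R p a.2 * w a.1).
    rewrite mulr_natl mulr2n {1}(gsum_reindex U1 Phi_bij) -gsumD //; last first.
      exact: summable_reindex Phi_bij sU1.
    apply: eq_gsum => a; rewrite /U1 /= z_Phi pthe_opp // w_Phi mulrNN.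
    by case: ifP; case: ifP; rewrite ?addr0 ?add0r //; lia.
  apply: two_reg; apply: (@sum_antisym _ _ _ (fun a => (a.1, -1 - a.2))) => //.
    by exists (fun a => (a.1, -1 - a.2)) => -[a j] /=; congr (_, _); lia.
  by move=> a; rewrite /= pthe_opp // mulNr.
have U2_0 : gsum U2 = 0.
  (* One factor 2 symmetrizes [U2] under [Phi] into a sum with weight [y]; the other makes $2y$ grow
     by 2 per period, like [phi], so that the difference is periodic modulo $p$. *)
  do 2 apply: two_reg.
  have -> : 2%:R * gsum U2 = gsum (fun a => y (s a) * w a).
    transitivity (gsum (fun a : I * int => (chi (s a.1) a.2)%:~R * w a.1)); last first.
      rewrite -(@gsum_pair _ _ _ (fun a j => (chi (s a) j)%:~R * w a)) //.
      by apply: eq_gsum => a; rewrite gsumMr.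
    rewrite mulr_natl mulr2n {2}(gsum_reindex U2 Phi_bij) -gsumD //; last first.
      exact: summable_reindex Phi_bij sU2.
    apply: eq_gsum => a; rewrite /U2 /= z_Phi w_Phi /chi -/(z a).
    have -> : (0 <= -1 - z a) && (-1 - a.2 < 0) = (z a < 0) && (0 <= a.2) by lia.
    by case: ifP => h1; case: ifP => h2;
      rewrite ?subr0 ?sub0r ?addr0 ?add0r ?mul1r ?mul0r ?mulN1r //; lia.
  rewrite -gsumMl; last exact: summableMr.
  have sphi : summable (fun a => (phi (s a))%:~R * w a) by apply: summableMr.
  have -> : gsum (fun a => 2%:R * (y (s a) * w a)) =
     gsum (fun a => (2%:R * y (s a) - (phi (s a))%:~R) * v (s a) ^+ (p - 2) * t a)
     + gsum (fun a => (phi (s a))%:~R * w a).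
    rewrite -gsumD //; last exact: summableMr.
    by apply: eq_gsum => a; rewrite /w; ring.
  rewrite (gsum_periodic (g := fun x => (2%:R * y x - (phi x)%:~R) * v x ^+ (p - 2))).
    by rewrite add0r -[RHS]phi0; apply: eq_gsum => a; rewrite /w; ring.
  move=> x; rewrite y_shift (intr_modp (phi_shift x)) rmorphD /=.
  have -> : v (x + p%:Z) = v x.
    rewrite /v; apply: intr_modp; apply/eqP; rewrite eqz_mod_dvd.
    by apply/dvdzP; exists 2%:Z; lia.
  by congr (_ * _); ring.
rewrite pr_appell; transitivity (8%:R * (gsum U1 - gsum U2)); last first.
  by rewrite U1_0 U2_0 subrr mulr0.
rewrite -gsumB //; congr (_ * _); rewrite -(gsum_fiber (fun a => `|z a|%N)); last first.
  by apply: summableD => //; apply: summableN.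
apply: eq_gsum => m.
have sX (x : int -> fps R) : summable (fun a : I * int => if z a == m then x a.2 * t a.1 else 0).
  have xT := @summable_index (fun=> 1) m.
  apply: eq_summable (summableMr (fun a : I * int => x a.2) (summable_pr p n0 xT)) => a.
  by rewrite -/(z a); case: ifP => _; rewrite ?mul1r ?raddf0 ?mulr0.
have sZ : summable (fun a : I * int => if z a == m then t a.1 else 0).
  by apply: eq_summable (sX (fun=> 1)) => a; rewrite mul1r.
have prC : pr (latC m) = gsum (fun a : I * int => if z a == m then pthz R p a.2 * t a.1 else 0).
  rewrite /latC gsum_pr; last exact: summable_index.
  apply: eq_gsum => a; rewrite -/(z a); case: ifP => _; last exact: raddf0.
  by rewrite pr_in_qpM //; apply: pthz_in_qp.
have zC : gsum (fun a : I * int => if z a == m then t a.1 else 0) = 0.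
  exact: etrans (gsum_index st sZ) (class_sum m).
rewrite -[pr _]subr0 -zC prC -gsumB //.
rewrite -gsumMl; last by apply: summableD => //; apply: summableN.
apply: eq_gsum => -[a j]; rewrite /U1 /U2 /=.
have [e|ne] := eqVneq (z (a, j)) m%:Z; last first.
  rewrite subr0 mulr0; case: eqP => // e; rewrite !ifN ?subr0 //.
    by apply: contra ne => /andP[z0 _]; rewrite -e gez0_abs.
  by apply: contra ne => z0; rewrite -e gez0_abs.
rewrite e absz_nat eqxx le0z_nat /= /w.
have -> : v m = v (s a).
  rewrite /v -e /z /=; apply: intr_modp; apply/eqP; rewrite eqz_mod_dvd.
  by apply/dvdzP; exists (2%:Z * j); ring.
rewrite /pthe; have [j0|j0] := boolP (0 <= j).
  have -> : j < 0 = false by lia.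
  by rewrite /= mulr1n; ring.
have -> : j < 0 by lia.
by rewrite /= mulr0n; ring.
Qed.
End LatticeSums.

(** * Theta series *)

Section Theta.
Variable R : comNzRingType.
Local Notation P := (@pinf R).

(* [itri a] is a (a - 1) / 2. *)
Definition itri (a : int) : nat :=
  match a with Posz n => tri n.-1 | Negz n => tri n.+1 end.
Lemma tri2 n : (tri n * 2 = n * n.+1)%N.
Proof. by elim: n => // n IH; rewrite triS mulnDl IH; nia. Qed.
Lemma itri2 a : (itri a)%:Z * 2%:Z = a * (a - 1).
Proof. by case: a => [[|n]|n]; rewrite -PoszM tri2 ?NegzE //; lia. Qed.

Definition th (a : int) : fps R := (-1) ^+ `|a| * qpow (itri a).

Lemma signr_int (a b : int) : (2%:Z %| a - b)%Z -> (-1) ^+ `|a| = (-1) ^+ `|b| :> fps R.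
Proof.
move=> ab; rewrite -signr_odd -[RHS]signr_odd; congr (_ ^+ nat_of_bool _).
case/dvdzP: ab => c e; apply/idP/idP; lia.
Qed.

Lemma th_flip a : th (1 - a) = - th a.
Proof.
rewrite /th; have -> : itri (1 - a) = itri a.
  have := itri2 (1 - a); have := itri2 a; nia.
have -> : (-1) ^+ `|1 - a| = - ((-1) ^+ `|a|) :> fps R.
  rewrite (@signr_int (1 - a) (`|a|.+1)) ?exprS ?mulN1r //; lia.
by rewrite mulNr.
Qed.

Lemma qpow_shift (x y : fps R) u0 v0 u v :
  qpow u0 * x = qpow v0 * y -> (u + v0 = v + u0)%N -> qpow u * x = qpow v * y.
Proof.
move=> e uv; apply: (@qpowM_inj _ v0); rewrite !mulrA -!qpowD addnC uv qpowD -mulrA e.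
by rewrite mulrA -qpowD addnC.
Qed.

(** The power $q^a$ is written as a quotient $q^u/q^v$ because $a$ may be negative. *)
Lemma th_shift a (u v : nat) : u%:Z - v%:Z = a -> qpow u * th a = - (qpow v * th (a + 1)).
Proof.
move=> uv; rewrite /th.
have -> : (-1) ^+ `|a + 1| = - ((-1) ^+ `|a|) :> fps R.
  rewrite (@signr_int (a + 1) (`|a|.+1)) ?exprS ?mulN1r //; lia.
rewrite mulNr mulrN opprK !(mulrCA (qpow _)) -!qpowD; congr (_ * qpow _).
have := itri2 (a + 1); have := itri2 a; nia.
Qed.

Lemma summable_th : summable th.
Proof.
apply: usummable_summable => N.
exists ([seq i%:Z | i <- iota 0 N.+2] ++ [seq - i%:Z | i <- iota 0 N.+2]) => a.
rewrite mem_cat negb_or => /andP[a1 a2]; apply: ordgeMr; apply: (ordgeW _ (ordge_qpow _ _)).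
have aN : (N.+1 < `|a|)%N.
  rewrite ltnNge; apply/negP => aN.
  have [e|e] : a = `|a|%N%:Z \/ a = - `|a|%N%:Z by lia.
    by case/negP: a1; rewrite e map_f // mem_iota; lia.
  by case/negP: a2; apply/mapP; exists `|a|%N; rewrite ?mem_iota //; lia.
have := itri2 a; nia.
Qed.

Definition odd_of (a : int) : int := 2%:Z * a - 1.
Local Notation X := odd_of.

(** Replacing $a$ by $1-a$ changes the sign of both [th a] and [X a], so an even [f] contributes
    nothing. *)
Definition tau (f : int -> int) : fps R := gsum (fun a => (f (X a))%:~R * th a).
Lemma summable_tau f : summable (fun a => (f (X a))%:~R * th a).
Proof. by apply: summableMr; apply: summable_th. Qed.

(** The indices $r+1$ and $-r$, both sent to $r$ by [mu], give equal terms, so the two-sided sum is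
    twice Jacobi's series up to sign. *)
Lemma tau1 : tau id = - (2%:R * P ^+ 3).
Proof.
pose mu (a : int) := if 0 < a then `|a|.-1 else `|a|%N.
have e := gsum_fiber mu (summable_tau id).
rewrite /tau -{}e jacobi_cube.
have o r : ordge r ((-1) ^+ r * r.*2.+1%:R * qpow (tri r) : fps R).
  by apply: ordgeMr; apply: ordge_tri.
rewrite -gsumMl; last exact: summable_nat.
rewrite -gsumN; last by apply: summableMr; apply: summable_nat.
apply: eq_gsum => r; apply: fpsP => n.
rewrite (@coef_gsum _ _ _ n [:: r.+1%:Z; - r%:Z]); last 2 first.
- by rewrite /= inE andbT; lia.
- move=> a; rewrite !inE negb_or => ar; case: eqP => // e.
  by move: e ar; rewrite /mu; case: ifP; lia.
have e1 : mu r.+1%:Z == r by rewrite /mu (_ : (0 < r.+1%:Z) = true).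
have e2 : mu (- r%:Z) == r by rewrite /mu (_ : (0 < - r%:Z) = false) ?abszN //; lia.
rewrite !big_cons big_nil addr0 e1 e2 -coefsD; congr (coefs _ n).
rewrite /th /itri /X.
have -> : match - r%:Z with Posz n => tri n.-1 | Negz n => tri n.+1 end = tri r by case: (r).
have -> : 2%:Z * r.+1%:Z - 1 = r.*2.+1%:Z by lia.
have -> : 2%:Z * - r%:Z - 1 = - r.*2.+1%:Z by lia.
rewrite abszN !absz_nat mulrNz exprS -!pmulrn; ring.
Qed.

(** Completing the square: $(2a-1)^2$ is 8 times the exponent $a(a-1)/2$, plus 1. *)
Lemma tauS f : tau (fun x => x ^+ 2 * f x) = 8%:R * qD (tau f) + tau f.
Proof.
rewrite /tau gsum_qD; last exact: summable_tau.
rewrite -gsumMl; last exact/summable_qD/summable_tau.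
rewrite -gsumD; last 2 first.
- exact/summableMr/summable_qD/summable_tau.
- exact: summable_tau.
apply: eq_gsum => a; rewrite qDM qD_int mul0r add0r /th qDM qDX raddfN /= qD1 oppr0 mulr0.
rewrite mul0r add0r qD_qpow.
have -> : X a ^+ 2 = 8%:Z * (itri a)%:Z + 1 by rewrite /X; have := itri2 a; nia.
by rewrite rmorphM rmorphD rmorphM /= -!pmulrn; ring.
Qed.
End Theta.

(** * Weighted theta sums and the modulus 5 *)

Section WeightedSums.
Variable R : comNzRingType.
Local Notation P := (@pinf R).
Local Notation X := odd_of.

Definition wsum (K : choiceType) (t : K -> fps R) (phi : K -> int) : fps R :=
  gsum (fun k => (phi k)%:~R * t k).

Section OneFamily.
Variables (K : choiceType) (t : K -> fps R).
Hypothesis st : summable t.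
Let sw phi : summable (fun k => (phi k)%:~R * t k : fps R).
Proof. exact: summableMr. Qed.

Lemma eq_wsum phi psi : phi =1 psi -> wsum t phi = wsum t psi.
Proof. by move=> e; apply: eq_gsum => k; rewrite e. Qed.
Lemma wsumD phi psi : wsum t (fun k => phi k + psi k) = wsum t phi + wsum t psi.
Proof. by rewrite -gsumD //; apply: eq_gsum => k; rewrite rmorphD mulrDl. Qed.
Lemma wsumZ (c : int) phi : wsum t (fun k => c * phi k) = c%:~R * wsum t phi.
Proof. by rewrite -gsumMl //; apply: eq_gsum => k; rewrite rmorphM mulrA. Qed.
Lemma wsum_perm (g : K -> K) phi : involutive g -> (forall k, t (g k) = t k) ->
  wsum t (phi \o g) = wsum t phi.
Proof.
move=> gK tg; rewrite [RHS](gsum_reindex _ (inv_bij gK)).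
by apply: eq_gsum => k; rewrite /= tg.
Qed.
Lemma wsum_flip (g : K -> K) phi : involutive g -> (forall k, t (g k) = - t k) ->
  2%:R * wsum t phi = wsum t (fun k => phi k - phi (g k)).
Proof.
move=> gK tg; rewrite mulr_natl mulr2n [X in _ + X = _](gsum_reindex _ (inv_bij gK)).
rewrite -gsumD //; last exact: (summable_reindex (inv_bij gK)).
by apply: eq_gsum => k; rewrite /= tg rmorphB; ring.
Qed.
Lemma pr_wsum0 p n phi : (forall k, (phi k)%:~R * pr p n (t k) = 0) ->
  pr p n (wsum t phi) = 0.
Proof.
move=> e; rewrite gsum_pr // gsum_eq0 // => k.
by rewrite pr_in_qpM //; apply: in_qp_int.
Qed.
End OneFamily.

Lemma wsumM (J K : choiceType) (t : J -> fps R) (u : K -> fps R) phi psi :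
  summable t -> summable u ->
  wsum (fun a : J * K => t a.1 * u a.2) (fun a => phi a.1 * psi a.2) =
  wsum t phi * wsum u psi.
Proof.
move=> st su; rewrite -gsumMM; [|exact: summableMr|exact: summableMr].
by apply: eq_gsum => a; rewrite rmorphM; ring.
Qed.

Definition th2 (a : int * int) : fps R := th R a.1 * th R a.2.
Lemma summable_th2 : summable th2.
Proof. by apply: summable_pairMM; apply: summable_th. Qed.

Lemma X_flip a : X (1 - a) = - X a. Proof. by rewrite /X; lia. Qed.

Definition flip1 K (a : int * K) := (1 - a.1, a.2).
Definition flip2 K (a : K * int) := (a.1, 1 - a.2).
Definition swap K (a : K * K) := (a.2, a.1).
Lemma flip1_inv K : involutive (@flip1 K).
Proof. by move=> [a k]; rewrite /flip1 /=; congr (_, _); lia. Qed.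
Lemma flip2_inv K : involutive (@flip2 K).
Proof. by move=> [a k]; rewrite /flip2 /=; congr (_, _); lia. Qed.
Lemma nat_diff (a : int) : exists u v : nat, u%:Z - v%:Z = a.
Proof. by case: a => n; [exists n, 0%N|exists 0%N, n.+1]; rewrite ?NegzE; lia. Qed.
Lemma th2_shift a (u v : nat) : u%:Z - v%:Z = a.1 + a.2 ->
  qpow u * th2 a = qpow v * th2 (a.1 + 1, a.2 + 1).
Proof.
case: a => a b /= e; have [u1 [v1 e1]] := nat_diff a; have [u2 [v2 e2]] := nat_diff b.
apply: (@qpow_shift _ _ _ (u1 + u2) (v1 + v2)); last by lia.
rewrite /th2 /= !qpowD mulrACA (th_shift _ e1) (th_shift _ e2); ring.
Qed.
Lemma th2_flip1 a : th2 (flip1 a) = - th2 a.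
Proof. by rewrite /th2 /= th_flip mulNr. Qed.
Lemma th2_flip2 a : th2 (flip2 a) = - th2 a.
Proof. by rewrite /th2 /= th_flip mulrN. Qed.
Lemma th2_swap a : th2 (swap a) = th2 a.
Proof. by rewrite /th2 mulrC. Qed.

Definition F2 (f : int -> int -> int) : fps R := wsum th2 (fun a => f (X a.1) (X a.2)).

Lemma F2_odd f : 4%:R * F2 f =
  F2 (fun x y => f x y - f (- x) y - f x (- y) + f (- x) (- y)).
Proof.
have e4 : 4%:R = 2%:R * 2%:R :> fps R by rewrite -natrM.
rewrite e4 -mulrA.
rewrite /F2 (wsum_flip summable_th2 _ (@flip1_inv _) th2_flip1).
rewrite (wsum_flip summable_th2 _ (@flip2_inv _) th2_flip2).
by apply: eq_wsum => -[a b]; rewrite /= !X_flip; ring.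
Qed.

Lemma F2M f g : F2 (fun x y => f x * g y) = tau R f * tau R g.
Proof.
by apply: (wsumM (fun a => f (X a)) (fun a => g (X a)));
  apply: summable_th.
Qed.

Lemma pr_monomial p n (x : fps R) m : in_qp p x ->
  pr p n (x * qpow m) = if (m == n %[mod p])%N then x * qpow m else 0.
Proof.
move=> xp; rewrite pr_in_qpM //; have -> : pr p n (qpow m) = if (m == n %[mod p])%N then qpow m else 0 :> fps R.
  apply: fpsP => k; rewrite coef_pr; have [->|km] := eqVneq k m; first by case: ifP.
  by case: ifP => _; case: ifP; rewrite //= (negbTE km).
by case: ifP => _ //; rewrite mulr0.
Qed.

Definition sg (a : int) : fps R := (-1) ^+ `|a|.
Lemma in_qp_sg p a : in_qp p (sg a).
Proof. exact/in_qpX/in_qpN/in_qp1. Qed.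
Lemma thE a : th R a = sg a * qpow (itri a). Proof. by []. Qed.
Lemma th2E a : th2 a = sg a.1 * sg a.2 * qpow (itri a.1 + itri a.2).
Proof. by rewrite /th2 !thE qpowD; ring. Qed.

Lemma X_sq a : X a ^+ 2 = 8%:Z * (itri a)%:Z + 1.
Proof. by rewrite /X; have := itri2 a; nia. Qed.

(** The derivative of a $p$-th power is 0, so $n c_n = 0$ for its coefficients, and $n$ is
    invertible unless $p$ divides it. *)
Lemma in_qp_expp p (x : fps R) : prime p -> p%:R = 0 :> fps R -> in_qp p (x ^+ p).
Proof.
move=> p_prime p0; apply/in_qpP => n pn; have p0R : p%:R = 0 :> R.
  by have /(congr1 (fun x => coefs x 0)) := p0; rewrite -[p%:R]mulr1 coefs_natM coefs1 mulr1.
have h : n%:R * coefs (x ^+ p) n = 0.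
  by rewrite -coef_qD qDX p0 !mul0r.
have n0 : (0 < n)%N by case: n pn {h}; rewrite ?dvdn0.
have /(coprimeP _ n0)[[u v] /= e] : coprime n p by rewrite coprime_sym prime_coprime.
have e' : u%:R * n%:R = 1 :> R.
  by rewrite -natrM (_ : u * n = v * p + 1)%N ?natrD ?natrM ?p0R ?mulr0 ?add0r //; lia.
by rewrite -[LHS]mul1r -e' -mulrA h mulr0.
Qed.
End WeightedSums.

(** * The modulus 5 *)

Section Mod5.
Variable R : comNzRingType.
Local Notation P := (@pinf R).
Local Notation X := odd_of.
Hypothesis p0 : 5%:R = 0 :> fps R.

Let reg2 x : 2%:R * x = 0 :> fps R -> x = 0. Proof. exact: (@two_reg R 5). Qed.
Let int5 a b : (a = b %[mod 5])%Z -> a%:~R = b%:~R :> fps R.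
Proof. exact: (@intr_modp R 5). Qed.
Lemma int5_0 (a : int) : (5 %| a)%Z -> a%:~R = 0 :> fps R.
Proof. by move=> /dvdzP[c ->]; rewrite rmorphM /= -[5%:~R]/(5%:R) p0 mulr0. Qed.

Lemma sq5 (x : int) : exists m, [\/ x ^+ 2 = 5%:Z * m /\ (5 %| x)%Z,
  x ^+ 2 = 5%:Z * m + 1 | x ^+ 2 = 5%:Z * m + 4%:Z].
Proof.
have e := divz_eq x 5; have := modz_ge0 x (isT : 5%:Z != 0).
have := ltz_pmod x (isT : 0 < 5%:Z).
move: (x %/ 5)%Z (x %% 5)%Z e => c r -> r5 r0.
have [] : r = 0 \/ r = 1 \/ r = 2%:Z \/ r = 3%:Z \/ r = 4%:Z by lia.
  move=> ->; exists (5%:Z * c ^+ 2); constructor 1; split; first by ring.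
  by rewrite addr0 dvdz_mull.
case=> [->|]; first by exists (5%:Z * c ^+ 2 + 2%:Z * c); constructor 2; ring.
case=> [->|]; first by exists (5%:Z * c ^+ 2 + 4%:Z * c); constructor 3; ring.
case=> [->|->]; first by exists (5%:Z * c ^+ 2 + 6%:Z * c + 1); constructor 3; ring.
by exists (5%:Z * c ^+ 2 + 8%:Z * c + 3%:Z); constructor 2; ring.
Qed.

(** Nonzero squares modulo 5 are $\pm1$, and three signs never add up to 0. *)
Lemma cone5 (x y z : int) : (5 %| x ^+ 2 + y ^+ 2 + z ^+ 2)%Z -> (5 %| x * y * z)%Z.
Proof.
have [l hx] := sq5 x; have [m hy] := sq5 y; have [n hz] := sq5 z.
case: hx => [[_ ?]|ex|ex]; first by rewrite !dvdz_mulr.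
  all: case: hy => [[_ ?]|ey|ey]; first by rewrite dvdz_mulr // dvdz_mull.
  all: case: hz => [[_ ?]|ez|ez]; first by rewrite dvdz_mull.
  all: by rewrite ex ey ez => /dvdzP[c]; lia.
Qed.

Lemma indicator5 (d : int) : (1 - d ^+ 4)%:~R = if (5 %| d)%Z then 1 else 0 :> fps R.
Proof.
case: ifP => [/int5_0 e|nd]; first by rewrite rmorphB rmorphXn /= e expr0n subr0.
have [m [[_ /idPn]|e|e]] := sq5 d; first by rewrite nd.
  apply: int5_0; apply/dvdzP; exists (- (5%:Z * m ^+ 2 + 2%:Z * m)).
  by rewrite (exprM d 2 2) e; ring.
apply: int5_0; apply/dvdzP; exists (- (5%:Z * m ^+ 2 + 8%:Z * m + 3%:Z)).
by rewrite (exprM d 2 2) e; ring.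
Qed.

Let I := (int * int)%type.
Let w : fps R := P^-1.
(** The exponent is $2\cdot3+1$: each of the two theta factors supplies $(q)^3$ through its first
    moment, which leaves $1/(q)$. *)
Let T (a : I) : fps R := w ^+ 7 * th2 R a.
Let s (a : I) : int := 1 + a.1 + a.2.

Lemma fermat5 (x : int) : (5 %| x - x ^+ 5)%Z.
Proof.
have nat n : (5 %| n%:Z - n%:Z ^+ 5)%Z.
  elim: n => [|n /dvdzP[c e]]; first by rewrite expr0n subr0 dvdz0.
  apply/dvdzP; exists (c - (n%:Z ^+ 4 + 2%:Z * n%:Z ^+ 3 + 2%:Z * n%:Z ^+ 2 + n%:Z)).
  rewrite -addn1 PoszD mulrBl -e; ring.
case: x => n; first exact: nat.
have /dvdzP[c e] := nat n.+1; apply/dvdzP; exists (- c).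
by rewrite NegzE mulNr -e; ring.
Qed.

Definition fq5 (x : int) : int := ((x - x ^+ 5) %/ 5)%Z.
Lemma fq5E x : x - x ^+ 5 = 5%:Z * fq5 x.
Proof. by rewrite mulrC divzK ?fermat5. Qed.
Lemma fq5D x y : fq5 (x + y) =
  fq5 x + fq5 y - x * y * (x + y) * (x ^+ 2 + x * y + y ^+ 2).
Proof.
apply: (@mulfI _ 5%:Z) => //; rewrite mulrBr mulrDr -!fq5E; ring.
Qed.
Lemma fq5N x : fq5 (- x) = - fq5 x.
Proof. by apply: (@mulfI _ 5%:Z) => //; rewrite mulrN -!fq5E; ring. Qed.

Let Pw : P * w = 1. Proof. exact: (divrr (pinf_unit R)). Qed.

Let th3 (a : int * I) : fps R := th R a.1 * th2 R a.2.
Let sth3 : summable th3.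
Proof. exact: (summable_pairMM (summable_th R) (summable_th2 R)). Qed.
Let F3 (f : int -> int -> int -> int) :=
  wsum th3 (fun a => f (X a.1) (X a.2.1) (X a.2.2)).

Lemma F3M f g : F3 (fun x y z => f x * g y z) = tau R f * F2 R g.
Proof.
by apply: (wsumM (fun a => f (X a)) (fun a : I => g (X a.1) (X a.2)));
  [apply: summable_th|apply: summable_th2].
Qed.

Lemma F3_swap f : F3 (fun x y z => f x z y) = F3 f.
Proof.
apply: (wsum_perm (g := fun a => (a.1, swap a.2))) => [[a [b c]]|[a b]] //.
by rewrite /th3 th2_swap.
Qed.
Lemma F3_swap12 f : F3 (fun x y z => f y x z) = F3 f.
Proof.
apply: (wsum_perm (g := fun a => (a.2.1, (a.1, a.2.2)))) => [[a [b c]]|[a [b c]]] //.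
by rewrite /th3 /th2 /=; ring.
Qed.

Lemma F3_odd f : 4%:R * F3 f =
  F3 (fun x y z => f x y z - f x (- y) z - f x y (- z) + f x (- y) (- z)).
Proof.
have e4 : 4%:R = 2%:R * 2%:R :> fps R by rewrite -natrM.
rewrite e4 -mulrA /F3.
rewrite (wsum_flip sth3 _ (g := fun a => (a.1, flip1 a.2))); last 2 first.
- by case=> a b /=; rewrite flip1_inv.
- by move=> a; rewrite /th3 /= th2_flip1 mulrN.
rewrite (wsum_flip sth3 _ (g := fun a => (a.1, flip2 a.2))); last 2 first.
- by case=> a b /=; rewrite flip2_inv.
- by move=> a; rewrite /th3 /= th2_flip2 mulrN.
by apply: eq_wsum => -[a [b c]]; rewrite /= !X_flip; ring.
Qed.

(** In degree $n$ the odd coordinates satisfy $x^2+y^2+z^2 = 8n+3$, which is 0 modulo 5 when $n$ is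
    4. *)
Lemma pr_F3 f : (forall x y z, (5 %| x ^+ 2 + y ^+ 2 + z ^+ 2)%Z -> (5 %| f x y z)%Z) ->
  pr 5 4 (F3 f) = 0.
Proof.
move=> f0; apply: pr_wsum0 => // -[a [b c]]; rewrite /th3 /= th2E thE /=.
have -> : sg R a * qpow (itri a) * (sg R b * sg R c * qpow (itri b + itri c)) =
  sg R a * sg R b * sg R c * qpow (itri a + (itri b + itri c)) by rewrite !qpowD; ring.
rewrite pr_monomial; last exact: in_qpM (in_qpM (in_qp_sg _ _ _) (in_qp_sg _ _ _)) (in_qp_sg _ _ _).
case: ifP => [e|_]; last exact: mulr0.
rewrite int5_0 ?mul0r //; apply: f0; rewrite !X_sq.
have /dvdzP[k ek] : (5 %| (itri a + (itri b + itri c))%N%:Z - 4%:Z)%Z.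
  by rewrite -eqz_mod_dvd !modz_nat.
by apply/dvdzP; exists (8%:Z * k + 7%:Z); lia.
Qed.

Let tau3 : tau R (fun x => x ^+ 2 * x) = - (2%:R * (24%:R * P ^+ 2 * qD P + P ^+ 3)).
Proof.
rewrite (tauS R id) tau1 raddfN /= qDM qD_nat mul0r add0r qDX /=; ring.
Qed.

Let pr_w10 (x : fps R) : pr 5 4 (w ^+ 10 * x) = w ^+ 10 * pr 5 4 x.
Proof. by apply: pr_in_qpM; rewrite (exprM w 2 5); apply: in_qp_expp. Qed.

(** Ramanujan's congruence for $p(5n+4)$, from $1/(q) = (q)^9/(q)^{10}$: the numerator is a triple
    theta sum with weight $xyz$, up to a factor, and the denominator is a series in $q^5$. *)
Lemma pr_pinfV5 : pr 5 4 w = 0.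
Proof.
do 3 apply: reg2.
have e : 2%:R * (2%:R * (2%:R * w)) =
    - (w ^+ 10 * F3 (fun x y z => x * (y * z))) :> fps R.
  rewrite (F3M id (fun y z => y * z)) (F2M R id id) tau1.
  transitivity (8%:R * ((P * w) ^+ 9 * w)); first by rewrite Pw; ring.
  by ring.
have z2 n : in_qp 5 (n%:R : fps R) by apply: (@in_qp_int _ _ n%:Z).
rewrite -!(pr_in_qpM _ _ (z2 2%N)) e raddfN /= pr_w10 pr_F3 ?mulr0 ?oppr0 //.
by move=> x y z /cone5; rewrite mulrA.
Qed.

(** By Fermat the class condition is the polynomial $1-d^4$. Of its monomials only $t^2xy$, $x^3y$
    and $xy^3$ are odd in both coordinates; they yield $(q)^6$ and its derivative. *)
Lemma T_class5 (m : nat) :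
  gsum (fun a => if (5%:Z %| m%:Z - s a)%Z then T a else 0) = rankA R m.
Proof.
pose t : int := 2%:Z * m%:Z + 1.
have -> : gsum (fun a => if (5%:Z %| m%:Z - s a)%Z then T a else 0) =
    w ^+ 7 * F2 R (fun x y => 1 - (t - x - y) ^+ 4).
  rewrite /F2 /wsum -gsumMl; last by apply/summableMr/summable_th2.
  apply: eq_gsum => a; rewrite mulrCA -/(T a).
  have -> : (1 - (t - X a.1 - X a.2) ^+ 4)%:~R = (1 - (m%:Z - s a) ^+ 4)%:~R :> fps R.
    apply: int5; apply/eqP; rewrite eqz_mod_dvd.
    have -> : t - X a.1 - X a.2 = 2%:Z * (m%:Z - s a) + 5%:Z by rewrite /t /s /X; ring.
    set d := m%:Z - s a; apply/dvdzP.
    exists (- (3%:Z * d ^+ 4 + 32%:Z * d ^+ 3 + 120%:Z * d ^+ 2 + 200%:Z * d + 125%:Z)).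
    by ring.
  by rewrite indicator5; case: ifP; rewrite ?mul1r ?mul0r.
apply/eqP; rewrite -subr_eq0; apply/eqP; do 2 apply: reg2.
have e : 2%:R * (2%:R * F2 R (fun x y => 1 - (t - x - y) ^+ 4)) =
    - (48%:R * t%:~R ^+ 2 * (tau R id * tau R id)
     + 32%:R * (tau R (fun x => x ^+ 2 * x) * tau R id)).
  rewrite mulrA -natrM F2_odd.
  have -> : (fun x y => 1 - (t - x - y) ^+ 4 - (1 - (t - - x - y) ^+ 4)
      - (1 - (t - x - - y) ^+ 4) + (1 - (t - - x - - y) ^+ 4)) =
    (fun x y => (- (48%:Z * t ^+ 2)) * (x * y) +
       ((- 16%:Z) * ((x ^+ 2 * x) * y) + (- 16%:Z) * (x * (y ^+ 2 * y)))).
    by apply/funext => x; apply/funext => y; ring.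
  have st2 := summable_th2 R.
  rewrite /F2 (wsumD st2) (wsumD st2) !(wsumZ st2).
  rewrite -/(F2 R (fun x y => x * y)) -/(F2 R (fun x y => x ^+ 2 * x * y)).
  rewrite -/(F2 R (fun x y => x * (y ^+ 2 * y))).
  rewrite (F2M R id id) (F2M R (fun x => x ^+ 2 * x) id) (F2M R id (fun x => x ^+ 2 * x)).
  by rewrite !(rmorphN, rmorphM, rmorphXn) /=; ring.
rewrite !mulrBr [2%:R * (w ^+ 7 * _)]mulrCA [2%:R * (w ^+ 7 * _)]mulrCA e.
rewrite tau3 tau1 /rankA (qDV (pinf_unit R)) -/w.
have tt : t%:~R ^+ 2 = 8%:R * (tri m)%:R + 1 :> fps R.
  rewrite -rmorphXn -natrM -(natrD _ _ 1) pmulrn; congr (_%:~R).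
  by rewrite /t; have := tri2 m; nia.
rewrite tt.
set d := qD P; set k := (tri m)%:R.
transitivity (- (192%:R * (8%:R * k + 1) * ((P * w) ^+ 6 * w)
  + 3072%:R * ((P * w) ^+ 5 * (w ^+ 2 * d)) + 128%:R * ((P * w) ^+ 6 * w))
  - 4%:R * (3%:R * (- w ^+ 2 * d) + k * w)); first by ring.
rewrite Pw.
(* Over the integers the difference is a multiple of 5; these are its coefficients divided by 5. *)
transitivity (5%:R * (- (308%:R * k * w + 64%:R * w + 612%:R * (w ^+ 2 * d)))); first by ring.
by rewrite p0 mul0r.
Qed.

Let sT : summable T. Proof. by apply: summableMr; apply: summable_th2. Qed.

(** The part odd in [x] and [y] consists of two equal contributions [A], each with a Fermat quotient
    of a single variable, and of a polynomial [B] divisible by $xyz$. *)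
Lemma F3_phi5 : pr 5 4 (F3 (fun z x y => z * ((x + y) ^+ 3 * fq5 (x + y)))) = 0.
Proof.
have z2 n : in_qp 5 (n%:R : fps R) by apply: (@in_qp_int _ _ n%:Z).
pose A := F3 (fun z x y => fq5 y * (z * (4%:Z * x ^+ 3 + 12%:Z * (x * y ^+ 2)))).
pose B := F3 (fun z x y => (z * x * y) * (- 4%:Z * (x ^+ 6 + 11%:Z * (x ^+ 4 * y ^+ 2)
  + 11%:Z * (x ^+ 2 * y ^+ 4) + y ^+ 6))).
have prB : pr 5 4 B = 0.
  by apply: pr_F3 => z x y /cone5 h; apply: dvdz_mulr.
have prA : pr 5 4 A = 0.
  apply: reg2; rewrite -pr_in_qpM //.
  (* Exchanging [z] and [x] brings in $z^2$, and $24y^2$ splits as $4y^2+20y^2$: modulo 5 the form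
     $x^2+y^2+z^2$ appears. *)
  have -> : 2%:R * A = F3 (fun z x y => fq5 y * (z * x) * (4%:Z * (z ^+ 2 + x ^+ 2 + y ^+ 2) + 20%:Z * y ^+ 2)).
    rewrite mulr_natl mulr2n {1}/A -F3_swap12 /A -wsumD //.
    by apply: eq_wsum => a; ring.
  apply: pr_F3 => z x y h; apply: dvdz_mull; apply: rpredD; first exact: dvdz_mull.
  by apply: dvdz_mulr.
do 2 apply: reg2; rewrite -!(pr_in_qpM _ _ (z2 2%N)) mulrA -natrM F3_odd.
rewrite (_ : F3 _ = A + A + B) ?raddfD /= ?prA ?prB ?addr0 //.
rewrite -{2}[A]F3_swap -!wsumD //; apply: eq_wsum => -[a [b c]] /=.
move: (X a) (X b) (X c) => z x y.
have -> : - x + - y = - (x + y) by ring.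
by rewrite fq5N !fq5D !fq5N; ring.
Qed.

(** At $x = s(a)$ the argument $2x+1-5$ is the sum of the odd coordinates. Since $2(q)^{-7} =
    (q)^{-10}\cdot 2(q)^3$ and $2(q)^3$ is minus the first theta moment, a third variable appears
    next to a series in $q^5$. *)
Theorem pr_appell5 : pr 5 4 (appell R * w) = 0.
Proof.
apply: (@pr_appell_eq0 R 5 2 _ _ _ p0 4 _ _ T s (fun a => (a.1 + 1, a.2 + 1))
  (fun a => (1 - a.1, 1 - a.2)) sT _ _ _ _ _ _ T_class5 pr_pinfV5
  (fun x => fq5 (2%:Z * x + 1 - 5%:Z))) => //.
- by exists (fun a => (a.1 - 1, a.2 - 1)) => -[a b] /=; congr (_, _); lia.
- by move=> [a b] /=; congr (_, _); lia.
- by move=> [a b]; rewrite /s /=; lia.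
- move=> a u v e; rewrite /T !(mulrCA (qpow _) (w ^+ 7)); congr (_ * _).
  have e' : u%:Z - v%:Z = a.1 + a.2 by rewrite e /s; ring.
  exact: (th2_shift R e').
- by move=> [a b]; rewrite /s /=; lia.
- by move=> [a b]; rewrite /T /th2 /= !th_flip mulrNN.
- move=> x; apply/eqP; rewrite eqz_mod_dvd.
  set y : int := 2%:Z * x + 1 - 5%:Z.
  have -> : 2%:Z * (x + 5%:Z) + 1 - 5%:Z = y + 10%:Z by rewrite /y; ring.
  rewrite fq5D; have := fq5E 10%:Z; set f := fq5 10%:Z => e10.
  have -> : f = (2%:Z - 20000%:Z) by apply: (@mulfI _ 5%:Z) => //; rewrite -e10; ring.
  apply/dvdzP; exists (- 4000%:Z - 2%:Z * y * (y + 10%:Z) * (y ^+ 2 + y * 10%:Z + 10%:Z ^+ 2)).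
  by ring.
apply: reg2; rewrite -gsumMl; last first.
  by apply: summableMr; apply: summable_pr.
pose G a := 2%:R * (odd_wt R (s a) ^+ 3 * (fq5 (2%:Z * s a + 1 - 5%:Z))%:~R * T a).
have GE : gsum G = - (w ^+ 10 * F3 (fun z x y => z * ((x + y) ^+ 3 * fq5 (x + y)))).
  rewrite (F3M id (fun x y => (x + y) ^+ 3 * fq5 (x + y))) tau1 /F2 /wsum.
  symmetry; transitivity (2%:R * (P * w) ^+ 3 * w ^+ 7 *
     gsum (fun a => ((X a.1 + X a.2) ^+ 3 * fq5 (X a.1 + X a.2))%:~R * th2 R a)); first by ring.
  rewrite Pw expr1n mulr1 -gsumMl; last by apply: summableMr; apply: summable_th2.
  apply: eq_gsum => a; rewrite /G /T.
  have -> : 2%:Z * s a + 1 - 5%:Z = X a.1 + X a.2 by rewrite /s /X; ring.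
  have -> : odd_wt R (s a) = (X a.1 + X a.2)%:~R.
    rewrite /odd_wt; apply: int5; apply/eqP; rewrite eqz_mod_dvd; apply/dvdzP; exists 1.
    by rewrite /s /X; ring.
  by rewrite rmorphM rmorphXn /=; ring.
transitivity (pr 5 4 (gsum G)); last by rewrite GE raddfN /= pr_w10 F3_phi5 mulr0 oppr0.
rewrite gsum_pr; last by do 2 apply: summableMr.
apply: eq_gsum => a.
have ip : in_qp 5 (2%:R * (odd_wt R (s a) ^+ 3 * (fq5 (2%:Z * s a + 1 - 5%:Z))%:~R)).
  by apply: in_qpM; [apply: (@in_qp_int _ _ 2%:Z)|apply: in_qpM; [apply: in_qpX|]; apply: in_qp_int].
by rewrite /G [in RHS]mulrA (pr_in_qpM _ _ ip) !mulrA.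
Qed.
End Mod5.

(** * The modulus 7 *)

Section Mod7.
Variable R : comNzRingType.
Local Notation P := (@pinf R).
Local Notation X := odd_of.
Hypothesis p0 : 7%:R = 0 :> fps R.

Let reg2 x : 2%:R * x = 0 :> fps R -> x = 0. Proof. exact: (@two_reg R 7). Qed.
Let int7 a b : (a = b %[mod 7])%Z -> a%:~R = b%:~R :> fps R.
Proof. exact: (@intr_modp R 7). Qed.
Lemma int7_0 (a : int) : (7 %| a)%Z -> a%:~R = 0 :> fps R.
Proof. by move=> /dvdzP[c ->]; rewrite rmorphM /= -[7%:~R]/(7%:R) p0 mulr0. Qed.
(** [ring] computes over the integers, so [z] hands it the difference of the two sides divided by
    7. *)
Lemma eq7 (z x y : fps R) : x = y + 7%:R * z -> x = y.
Proof. by rewrite p0 mul0r addr0. Qed.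

Lemma sq7 (x : int) : exists m, [\/ x ^+ 2 = 7%:Z * m /\ (7 %| x)%Z,
  x ^+ 2 = 7%:Z * m + 1, x ^+ 2 = 7%:Z * m + 2%:Z | x ^+ 2 = 7%:Z * m + 4%:Z].
Proof.
have e := divz_eq x 7; have := modz_ge0 x (isT : 7%:Z != 0).
have := ltz_pmod x (isT : 0 < 7%:Z).
move: (x %/ 7)%Z (x %% 7)%Z e => c r -> r5 r0.
have [] : r = 0 \/ r = 1 \/ r = 2%:Z \/ r = 3%:Z \/ r = 4%:Z \/ r = 5%:Z \/ r = 6%:Z by lia.
  move=> ->; exists (7%:Z * c ^+ 2); constructor 1; split; first by ring.
  by rewrite addr0 dvdz_mull.
case=> [->|]; first by exists (7%:Z * c ^+ 2 + 2%:Z * c); constructor 2; ring.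
case=> [->|]; first by exists (7%:Z * c ^+ 2 + 4%:Z * c); constructor 4; ring.
case=> [->|]; first by exists (7%:Z * c ^+ 2 + 6%:Z * c + 1); constructor 3; ring.
case=> [->|]; first by exists (7%:Z * c ^+ 2 + 8%:Z * c + 2%:Z); constructor 3; ring.
case=> [->|->]; first by exists (7%:Z * c ^+ 2 + 10%:Z * c + 3%:Z); constructor 4; ring.
by exists (7%:Z * c ^+ 2 + 12%:Z * c + 5%:Z); constructor 2; ring.
Qed.

(** $-1$ is not a square modulo 7. *)
Lemma cone7 (x y : int) : (7 %| x ^+ 2 + y ^+ 2)%Z -> (7 %| x)%Z && (7 %| y)%Z.
Proof.
have [m hx] := sq7 x; have [n hy] := sq7 y.
case: hx => [[ex x7]|ex|ex|ex]; case: hy => [[ey y7]|ey|ey|ey];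
  rewrite ex ey => /dvdzP[c]; by [rewrite x7 y7|lia].
Qed.

Lemma indicator7 (d : int) : (1 - d ^+ 6)%:~R = if (7 %| d)%Z then 1 else 0 :> fps R.
Proof.
case: ifP => [/int7_0 e|nd]; first by rewrite rmorphB rmorphXn /= e expr0n subr0.
have [m [[_ /idPn]|e|e|e]] := sq7 d; first by rewrite nd.
- apply: int7_0; apply/dvdzP; exists (- (49%:Z * m ^+ 3 + 21%:Z * m ^+ 2 + 3%:Z * m)).
  by rewrite (exprM d 2 3) e; ring.
- apply: int7_0; apply/dvdzP; exists (- (49%:Z * m ^+ 3 + 42%:Z * m ^+ 2 + 12%:Z * m + 1)).
  by rewrite (exprM d 2 3) e; ring.
apply: int7_0; apply/dvdzP; exists (- (49%:Z * m ^+ 3 + 84%:Z * m ^+ 2 + 48%:Z * m + 9%:Z)).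
by rewrite (exprM d 2 3) e; ring.
Qed.

Lemma fermat7 (x : int) : (7 %| x - x ^+ 7)%Z.
Proof.
have nat n : (7 %| n%:Z - n%:Z ^+ 7)%Z.
  elim: n => [|n /dvdzP[c e]]; first by rewrite expr0n subr0 dvdz0.
  apply/dvdzP; exists (c - (n%:Z ^+ 6 + 3%:Z * n%:Z ^+ 5 + 5%:Z * n%:Z ^+ 4
    + 5%:Z * n%:Z ^+ 3 + 3%:Z * n%:Z ^+ 2 + n%:Z)).
  rewrite -addn1 PoszD mulrBl -e; ring.
case: x => n; first exact: nat.
have /dvdzP[c e] := nat n.+1; apply/dvdzP; exists (- c).
by rewrite NegzE mulNr -e; ring.
Qed.

Definition fq7 (x : int) : int := ((x - x ^+ 7) %/ 7)%Z.
Lemma fq7E x : x - x ^+ 7 = 7%:Z * fq7 x.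
Proof. by rewrite mulrC divzK ?fermat7. Qed.
Lemma fq7D x y : fq7 (x + y) =
  fq7 x + fq7 y - x * y * (x + y) * (x ^+ 2 + x * y + y ^+ 2) ^+ 2.
Proof.
apply: (@mulfI _ 7%:Z) => //; rewrite mulrBr mulrDr -!fq7E; ring.
Qed.
Lemma fq7N x : fq7 (- x) = - fq7 x.
Proof. by apply: (@mulfI _ 7%:Z) => //; rewrite mulrN -!fq7E; ring. Qed.

Lemma fq7_7M k : fq7 (7%:Z * k) = k - 7%:Z * (49%:Z * 343%:Z * k ^+ 7).
Proof. by apply: (@mulfI _ 7%:Z) => //; rewrite -fq7E; ring. Qed.

Let I := ((int * int) * (int * int))%type.
Let w : fps R := P^-1.
Let Pw : P * w = 1. Proof. exact: (divrr (pinf_unit R)). Qed.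
Let th4 (a : I) : fps R := th2 R a.1 * th2 R a.2.
Let sth4 : summable th4.
Proof. exact: (summable_pairMM (summable_th2 R) (summable_th2 R)). Qed.
Let T (a : I) : fps R := w ^+ 13 * th4 a.
Let s (a : I) : int := 1 + a.1.1 + a.1.2 + a.2.1 + a.2.2.
Let F4 (f : int -> int -> int -> int -> int) :=
  wsum th4 (fun a => f (X a.1.1) (X a.1.2) (X a.2.1) (X a.2.2)).

Lemma F4M f g : F4 (fun x y z u => f x y * g z u) = F2 R f * F2 R g.
Proof.
by apply: (wsumM (fun a : int * int => f (X a.1) (X a.2))
  (fun a : int * int => g (X a.1) (X a.2))); apply: summable_th2.
Qed.

(** Sixteen times the part of [f] that is odd in each variable. *)
Definition odd4 (f : int -> int -> int -> int -> int) x y z u : int :=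
  let f1 x y z u := f x y z u - f (- x) y z u in
  let f2 x y z u := f1 x y z u - f1 x (- y) z u in
  let f3 x y z u := f2 x y z u - f2 x y (- z) u in
  f3 x y z u - f3 x y z (- u).

Lemma F4_odd f : 16%:R * F4 f = F4 (odd4 f).
Proof.
have e16 : 16%:R = 2%:R * (2%:R * (2%:R * 2%:R)) :> fps R by rewrite -!natrM.
rewrite e16 -!mulrA /F4.
rewrite (wsum_flip sth4 _ (g := fun a => (flip1 a.1, a.2))); last 2 first.
- by case=> a b /=; rewrite flip1_inv.
- by move=> a; rewrite /th4 /= th2_flip1 mulNr.
rewrite (wsum_flip sth4 _ (g := fun a => (flip2 a.1, a.2))); last 2 first.
- by case=> a b /=; rewrite flip2_inv.
- by move=> a; rewrite /th4 /= th2_flip2 mulNr.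
rewrite (wsum_flip sth4 _ (g := fun a => (a.1, flip1 a.2))); last 2 first.
- by case=> a b /=; rewrite flip1_inv.
- by move=> a; rewrite /th4 /= th2_flip1 mulrN.
rewrite (wsum_flip sth4 _ (g := fun a => (a.1, flip2 a.2))); last 2 first.
- by case=> a b /=; rewrite flip2_inv.
- by move=> a; rewrite /th4 /= th2_flip2 mulrN.
by apply: eq_wsum => -[[a b] [c d]]; rewrite /odd4 /= !X_flip.
Qed.

(* [(c, ((f, g), (h, k)))] stands for [c f(x) g(y) h(z) k(u)]. *)
Definition combination4 :=
  seq (int * (((int -> int) * (int -> int)) * ((int -> int) * (int -> int)))).

Lemma F4_sum (l : combination4) f :
  (forall x y z u, odd4 f x y z u =
     16%:Z * \sum_(e <- l) e.1 * ((e.2.1.1 x * e.2.1.2 y) * (e.2.2.1 z * e.2.2.2 u))) ->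
  F4 f = \sum_(e <- l) e.1%:~R *
     ((tau R e.2.1.1 * tau R e.2.1.2) * (tau R e.2.2.1 * tau R e.2.2.2)).
Proof.
move=> fE.
pose g (l : combination4) x y z u : int :=
  \sum_(e <- l) e.1 * ((e.2.1.1 x * e.2.1.2 y) * (e.2.2.1 z * e.2.2.2 u)).
have -> : F4 f = F4 (g l).
  apply/eqP; rewrite -subr_eq0; apply/eqP; do 4 apply: reg2.
  transitivity (16%:R * F4 f - 16%:R * F4 (g l)); first by ring.
  rewrite F4_odd /F4 -[16%:R]/(16%:~R) -(wsumZ sth4).
  by apply/eqP; rewrite subr_eq0; apply/eqP; apply: eq_wsum => a; apply: fE.
elim: l {f fE} => [|[c [[f1 f2] [f3 f4]]] l IH].
  by rewrite big_nil; apply: gsum_eq0 => a; rewrite /g big_nil mul0r.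
rewrite big_cons -IH /= -(F2M R f1 f2) -(F2M R f3 f4) -F4M /F4 -(wsumZ sth4) -(wsumD sth4).
by apply: eq_wsum => a; rewrite /g big_cons.
Qed.

Let cb (x : int) : int := x ^+ 2 * x.
Let q5 (x : int) : int := x ^+ 2 * cb x.
Let s7 (x : int) : int := x ^+ 2 * q5 x.
Let n9 (x : int) : int := x ^+ 2 * s7 x.

Let tau3 : tau R cb = - (2%:R * (24%:R * P ^+ 2 * qD P + P ^+ 3)).
Proof.
rewrite (tauS R id) tau1 raddfN /= qDM qD_nat mul0r add0r qDX /=; ring.
Qed.

(** The monomials of $(t-x-y-z-u)^6$ odd in each coordinate are $t^2xyzu$ and those of type
    $x^3yzu$, with coefficients $6!/2! = 360$ and $6!/3! = 120$. *)
Lemma T_class7 (m : nat) :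
  gsum (fun a => if (7%:Z %| m%:Z - s a)%Z then T a else 0) = rankA R m.
Proof.
pose t : int := 2%:Z * m%:Z + 1.
have -> : gsum (fun a => if (7%:Z %| m%:Z - s a)%Z then T a else 0) =
    w ^+ 13 * F4 (fun x y z u => 1 - (t - x - y - z - u) ^+ 6).
  rewrite /F4 /wsum -gsumMl; last exact: summableMr.
  apply: eq_gsum => a; rewrite mulrCA -/(T a).
  have -> : (1 - (t - X a.1.1 - X a.1.2 - X a.2.1 - X a.2.2) ^+ 6)%:~R =
      (1 - (m%:Z - s a) ^+ 6)%:~R :> fps R.
    apply: int7; apply/eqP; rewrite eqz_mod_dvd.
    have -> : t - X a.1.1 - X a.1.2 - X a.2.1 - X a.2.2 = 2%:Z * (m%:Z - s a) + 7%:Z.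
      by rewrite /t /s /X; ring.
    set d := m%:Z - s a; apply/dvdzP.
    exists (- (9%:Z * d ^+ 6 + 192%:Z * d ^+ 5 + 1680%:Z * d ^+ 4 + 7840%:Z * d ^+ 3
      + 20580%:Z * d ^+ 2 + 28812%:Z * d + 16807%:Z)).
    by ring.
  by rewrite indicator7; case: ifP; rewrite ?mul1r ?mul0r.
have e : F4 (fun x y z u => 1 - (t - x - y - z - u) ^+ 6) =
    - (360%:R * t%:~R ^+ 2 * tau R id ^+ 4 + 480%:R * (tau R cb * tau R id ^+ 3)).
  rewrite (@F4_sum [:: (- (360%:Z * t ^+ 2), ((id, id), (id, id)));
    (- 120%:Z, ((cb, id), (id, id))); (- 120%:Z, ((id, cb), (id, id)));
    (- 120%:Z, ((id, id), (cb, id))); (- 120%:Z, ((id, id), (id, cb)))]).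
    by rewrite !big_cons big_nil /= !mulrNz intrM rmorphXn /= -!pmulrn; ring.
  by move=> x y z u; rewrite !big_cons big_nil /odd4 /cb /=; ring.
rewrite e tau3 tau1 /rankA (qDV (pinf_unit R)) -/w.
have tt : t%:~R ^+ 2 = 8%:R * (tri m)%:R + 1 :> fps R.
  rewrite -rmorphXn -natrM -(natrD _ _ 1) pmulrn; congr (_%:~R).
  by rewrite /t; have := tri2 m; nia.
rewrite tt; set d := qD P; set k := (tri m)%:R.
apply: (@eq7 (- (29%:R * 227%:R * k * w + 1920%:R * w + 201%:R * 131%:R * (w ^+ 2 * d)))).
transitivity (- (360%:R * 16%:R * (8%:R * k + 1) * ((P * w) ^+ 12 * w)
  + 480%:R * 16%:R * (24%:R * ((P * w) ^+ 11 * (w ^+ 2 * d)) + (P * w) ^+ 12 * w))).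
  by ring.
by rewrite Pw; ring.
Qed.

Let fx2 (x : int) : int := x ^+ 2 * fq7 x.
(* Symmetric sums over the placements of the given functions on the four
   variables, the identity being put on the remaining ones. *)
Let one3 (c : int) (f g : int -> int) : combination4 :=
  [:: (c, ((f, g), (id, id))); (c, ((f, id), (g, id))); (c, ((f, id), (id, g)))].
Let all12 c (f g : int -> int) :=
  one3 c f g ++
  [:: (c, ((g, f), (id, id))); (c, ((id, f), (g, id))); (c, ((id, f), (id, g)));
      (c, ((g, id), (f, id))); (c, ((id, g), (f, id))); (c, ((id, id), (f, g)));
      (c, ((g, id), (id, f))); (c, ((id, g), (id, f))); (c, ((id, id), (g, f)))].
Let all4 (c : int) (f : int -> int) : combination4 :=
  [:: (c, ((f, id), (id, id))); (c, ((id, f), (id, id)));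
      (c, ((id, id), (f, id))); (c, ((id, id), (id, f)))].
Let all6 c (f : int -> int) := one3 c f f ++
  [:: (c, ((id, f), (f, id))); (c, ((id, f), (id, f))); (c, ((id, id), (f, f)))].
Let all12_533 (c : int) : combination4 :=
  [:: (c, ((q5, cb), (cb, id))); (c, ((q5, cb), (id, cb))); (c, ((q5, id), (cb, cb)));
      (c, ((cb, q5), (cb, id))); (c, ((cb, q5), (id, cb))); (c, ((id, q5), (cb, cb)));
      (c, ((cb, cb), (q5, id))); (c, ((cb, id), (q5, cb))); (c, ((id, cb), (q5, cb)));
      (c, ((cb, cb), (id, q5))); (c, ((cb, id), (cb, q5))); (c, ((id, cb), (cb, q5)))].

(** Let $S = x+y+z+u$. The terms with a Fermat quotient of one variable come from $S^5$, with $60 =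
    5!/2!$ and $20 = 5!/3!$. The rest is $S^5(x^7+y^7+z^7+u^7-S^7)/7$: for instance $x^9yzu$ has
    coefficient $(60-12!/9!)/7 = -180$, and $x^3y^3z^3u^3$ has $-12!/(7\cdot6^4) = -220\cdot240$. *)
Lemma odd4_phi x y z u :
  odd4 (fun x y z u => (x + y + (z + u)) ^+ 5 * fq7 (x + y + (z + u))) x y z u =
  16%:Z * \sum_(e <- all4 60%:Z fx2 ++ all12 20%:Z fq7 cb ++ all4 (- 180%:Z) n9
     ++ all12 (- (20%:Z * 113%:Z)) s7 cb ++ all6 (- (72%:Z * 66%:Z)) q5
     ++ all12_533 (- (120%:Z * 132%:Z)) ++ [:: (- (220%:Z * 240%:Z), ((cb, cb), (cb, cb)))])
    e.1 * ((e.2.1.1 x * e.2.1.2 y) * (e.2.2.1 z * e.2.2.2 u)).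
Proof.
rewrite /odd4 !fq7D !fq7N.
rewrite !big_cat /all4 /all12 /all6 /all12_533 /one3 !big_cons !big_nil /fx2 /n9 /s7 /q5 /cb /=.
move: (fq7 x) (fq7 y) (fq7 z) (fq7 u) => a b c d.
ring.
Qed.

Let in7 (n : nat) : in_qp 7 (n%:R : fps R). Proof. exact: (@in_qp_int _ _ n%:Z). Qed.
Let in7i (n : int) : in_qp 7 (n%:~R : fps R). Proof. exact: in_qp_int. Qed.
Let inX7 (x : fps R) : in_qp 7 (x ^+ 7). Proof. exact: in_qp_expp. Qed.

(** In degree $n$ the odd coordinates satisfy $x^2+y^2 = 8n+2$, which is 0 modulo 7 when $n$ is 5,
    so [cone7] applies. *)
Lemma pr_F2_7 f : (forall x y, (7 %| x)%Z -> (7 %| y)%Z -> (7 %| f x y)%Z) ->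
  pr 7 5 (F2 R f) = 0.
Proof.
move=> f0; apply: pr_wsum0 => [|[a b]]; first exact: summable_th2.
rewrite th2E /= pr_monomial; last exact: in_qpM (in_qp_sg _ _ _) (in_qp_sg _ _ _).
case: ifP => [e|_]; last exact: mulr0.
have /andP[a7 b7] : (7 %| X a)%Z && (7 %| X b)%Z.
  apply: cone7; rewrite !X_sq.
  have /dvdzP[k ek] : (7 %| (itri a + itri b)%N%:Z - 5%:Z)%Z.
    by rewrite -eqz_mod_dvd !modz_nat.
  by apply/dvdzP; exists (8%:Z * k + 6%:Z); lia.
by rewrite int7_0 ?mul0r //; apply: f0.
Qed.

(** The two first moments supply $4(q)^6$ and complete the factor $(q)$ to $(q)^7$, a series in
    $q^7$; a double theta sum remains. *)
Lemma pr_tau2 f g : (forall x, (7 %| x)%Z -> (7 %| g x)%Z) ->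
  pr 7 5 (P * ((tau R f * tau R g) * (tau R id * tau R id))) = 0.
Proof.
move=> g0; rewrite -(F2M R f g) tau1.
have -> : P * (F2 R (fun x y => f x * g y) * (- (2%:R * P ^+ 3) * - (2%:R * P ^+ 3))) =
   4%:R * (P ^+ 7 * F2 R (fun x y => f x * g y)) by ring.
rewrite !pr_in_qpM // pr_F2_7 ?mulr0 // => x y _ /g0; exact: dvdz_mull.
Qed.

(** Ramanujan's congruence for $p(7n+5)$, from $1/(q) = (q)^6/(q)^7$. *)
Lemma pr_pinfV7 : pr 7 5 w = 0.
Proof.
do 2 apply: reg2; rewrite -!pr_in_qpM //.
have -> : 2%:R * (2%:R * w) = w ^+ 7 * F2 R (fun x y => x * y).
  rewrite (F2M R id id) tau1.
  transitivity (4%:R * ((P * w) ^+ 6 * w)); first by rewrite Pw; ring.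
  by ring.
by rewrite pr_in_qpM // pr_F2_7 ?mulr0 // => x y _; apply: dvdz_mull.
Qed.

(* By the pentagonal number theorem 24 n + 1 is a square when q^n occurs in P. *)
Lemma pinf_coef7 n : coefs P n = 0 \/ (exists k : nat, 24 * n + 1 = k ^ 2)%N.
Proof.
have /ordgeP/(_ n (ltnSn n)) := @euler_pentagonal_trunc R n.+1.
rewrite coefsB => /eqP; rewrite subr_eq0 => /eqP ->; rewrite coefs_sum.
have [[k ek]|no] := pselect (exists k, 24 * n + 1 = k ^ 2)%N; first by right; exists k.
left; rewrite big1 // => i _; move: (nat_of_ord i) => [|r].
  rewrite -[alpha R 0]/(1 : fps R) coefs1; case: eqP => // n0; case: no; exists 1%N; lia.
rewrite alphaS mulrDr mulr1 -mulrA -qpowD.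
have -> : (-1) ^+ r.+1 = ((-1) ^+ r.+1)%:~R :> fps R by rewrite rmorphXn rmorphN1.
have t2 := tri2 r; have pt : (pent r.+1 * 2 = r.+1 * (3 * r + 2))%N.
  by elim: (r) => // m IH; rewrite pentS mulnDl IH; lia.
rewrite coefsD !coefs_intM /=; case: eqP => [e|_].
  by case: no; exists (6 * r + 5)%N; rewrite e; nia.
case: eqP => [e|_]; last by rewrite !mulr0 addr0.
by case: no; exists (6 * r + 7)%N; rewrite e; nia.
Qed.

(** * Differential equations from Euler's and Jacobi's identities modulo 7 *)

Let c0 := pr 7 2 P.
(** The shift 5 is adapted to both identities: $24n+1 = 3(n+5)$ modulo 7, and as $3\cdot5 = 1$ it
    acts on a cube as $q\,d/dq+1$. *)
Let P1 := qD P + 5%:R * P.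
Let P2 := qD P1 + 5%:R * P1.

Let p0R : 7%:R = 0 :> R.
Proof.
by have /(congr1 (fun x => coefs x 0)) := p0; rewrite -[7%:R]mulr1 coefs_natM coefs1 mulr1.
Qed.
Let natr7 n m : (n = m %[mod 7])%N -> n%:R = m%:R :> R.
Proof.
move=> e; rewrite (divn_eq n 7) (divn_eq m 7) e !natrD !natrM p0R !mulr0 //.
Qed.

(** If $24n+1 = k^2$ then $(n+5)^3 = (5k^2)^3 = -k^6$ modulo 7, which is $-1$ unless 7 divides $k$,
    that is, unless $n$ is 2 modulo 7. *)
Lemma euler7 : qD P2 + 5%:R * P2 = c0 - P.
Proof.
apply: fpsP => n; rewrite coefsB coef_pr coefsD coef_qD coefs_natM /P2 coefsD coef_qD coefs_natM.
rewrite /P1 coefsD coef_qD coefs_natM; set c := coefs P n.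
transitivity (((n + 5) ^ 3)%:R * c); first by rewrite natrX natrD; ring.
have [cn|[k ek]] := pinf_coef7 n; first by rewrite /c cn mulr0 if_same subr0.
have key : all (fun a => all (fun b => ((24 * a + 1) %% 7 == b ^ 2 %% 7) ==>
    ((a == 2) || ((a + 5) ^ 3 %% 7 == 6)))%N (iota 0 7)) (iota 0 7) by [].
have nk : ((24 * (n %% 7) + 1) %% 7 == (k %% 7) ^ 2 %% 7)%N.
  by rewrite modnXm -ek -modnDml modnMmr modnDml.
have hn : (n %% 7)%N \in iota 0 7 by rewrite mem_iota ltn_pmod.
have hk : (k %% 7)%N \in iota 0 7 by rewrite mem_iota ltn_pmod.
have := allP (allP key _ hn) _ hk; rewrite nk implyTb.
have n3 : ((n + 5) ^ 3 = ((n %% 7 + 5) ^ 3) %[mod 7])%N by rewrite -modnXm -modnDml modnXm.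
rewrite (natr7 n3) -[(n == 2 %[mod 7])%N]/(n %% 7 == 2)%N; case: eqP => [-> _|_ /= /eqP e].
  by rewrite (@natr7 _ 0) // mul0r subrr.
rewrite (@natr7 _ 6) ?e // sub0r; apply/eqP; rewrite -subr_eq0 opprK.
have -> : 6%:R * c + c = 7%:R * c by ring.
by rewrite p0R mul0r.
Qed.

Lemma qD_c0 : qD c0 = 2%:R * c0.
Proof.
apply: fpsP => n; rewrite coef_qD coefs_natM coef_pr.
by case: eqP => [e|_]; rewrite ?mulr0 // (natr7 e).
Qed.

Lemma tau_s7 : tau R s7 = tau R id.
Proof.
apply: eq_gsum => a; congr (_ * _); apply: int7; apply/eqP; rewrite eqz_mod_dvd.
have -> : s7 (X a) - X a = - (X a - X a ^+ 7) by rewrite /s7 /q5 /cb; ring.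
by rewrite rpredN fermat7.
Qed.

(** [U1] and [U2] are the first two images of $(q)^3$ under $q\,d/dq+1$ modulo 7. *)
Let U1 : fps R := 3%:R * P ^+ 2 * P1.
Let U2 : fps R := 6%:R * P * P1 ^+ 2 + 3%:R * P ^+ 2 * P2.

Lemma qDP : qD P = P1 - 5%:R * P. Proof. by rewrite /P1; ring. Qed.
Lemma qDP1 : qD P1 = P2 - 5%:R * P1. Proof. by rewrite /P2; ring. Qed.
Lemma qDP2 : qD P2 = c0 - P - 5%:R * P2. Proof. by rewrite -euler7; ring. Qed.

Lemma tau_cb : tau R cb = - (2%:R * U1).
Proof.
rewrite tau3 qDP /U1.
by apply: (@eq7 (- (2%:R * (3%:R * P ^+ 2 * P1 - 17%:R * P ^+ 3)))); ring.
Qed.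

Lemma tau_q5 : tau R q5 = - (2%:R * U2).
Proof.
rewrite /q5 tauS tau_cb raddfN /= /U1 !qDM !qD_nat ?qDX /= ?qDP qDP1 /U2.
apply: (@eq7 (- (2%:R * (6%:R * P * P1 ^+ 2 + 3%:R * P ^+ 2 * P2 - 51%:R * P ^+ 2 * P1)))).
by ring.
Qed.

(** The weights satisfy $x^7 = x$, so three applications of $8q\,d/dq+1$ fix $(q)^3$ modulo 7;
    [euler7] eliminates the third derivative of $(q)$. *)
Lemma jacobi7 : P ^+ 3 = 6%:R * P1 ^+ 3 + 18%:R * P * P1 * P2 + 3%:R * P ^+ 2 * (c0 - P).
Proof.
have e : - (2%:R * P ^+ 3) = 8%:R * qD (tau R q5) + tau R q5.
  by rewrite -tau1 -tau_s7 [in LHS]/s7 tauS.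
have {}e : 2%:R * (P ^+ 3 - (8%:R * qD U2 + U2)) = 0.
  move/eqP: e; rewrite tau_q5 raddfN /= qDM qD_nat => /eqP e.
  transitivity (- (- (2%:R * P ^+ 3)) - 2%:R * (8%:R * qD U2 + U2)); first by ring.
  by rewrite e; ring.
move/reg2/eqP: e; rewrite subr_eq0 => /eqP ->.
rewrite /U2 raddfD /= !qDM !qD_nat ?qDX /= ?qDP qDP1 qDP2.
apply: (@eq7 (6%:R * P1 ^+ 3 + 18%:R * P * P1 * P2 + 3%:R * P ^+ 2 * (c0 - P)
  - 102%:R * P * P1 ^+ 2 - 51%:R * P ^+ 2 * P2)).
by ring.
Qed.

(** On these exponents $n+2$ is divisible by 7, so images of $q\,d/dq+2$ are invisible there. *)
Lemma pr_qD7 x : pr 7 5 (qD x + 2%:R * x) = 0 :> fps R.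
Proof.
apply: fpsP => n; rewrite coef_pr coefsD coef_qD coefs_natM; case: eqP => [e|_ //].
by rewrite (natr7 e) -mulrDl -natrD p0R mul0r.
Qed.

(** [16 P^7 H] is an explicit primitive for $q\,d/dq+2$, with [P ^+ 7] acting as a constant: up to
    multiples of 7, the two sides differ by [48 P^9 P1] times the relation [jacobi7]. *)
Lemma pr_quartic :
  pr 7 5 (P * (tau R cb ^+ 4 + 12%:R * (tau R q5 * tau R cb ^+ 2 * tau R id))) = 0.
Proof.
pose H := - (P ^+ 3 * P1 ^+ 3) + c0 * P ^+ 5 + 2%:R * P ^+ 6.
rewrite -(pr_qD7 (16%:R * (P ^+ 7 * H))); congr (pr 7 5 _).
rewrite tau_cb tau_q5 tau1.
have j : P ^+ 9 * P1 * (6%:R * P1 ^+ 3 + 18%:R * P * P1 * P2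
    + 3%:R * P ^+ 2 * (c0 - P) - P ^+ 3) = 0 by rewrite -jacobi7 subrr mulr0.
apply: (@eq7 (16%:R * P ^+ 7 * (102%:R * P ^+ 2 * P1 ^+ 4 + 39%:R * P ^+ 3 * P1 ^+ 2 * P2
   - 4%:R * P ^+ 3 * P1 ^+ 3 - 2%:R * c0 * P ^+ 4 * P1 + 3%:R * c0 * P ^+ 5 + 8%:R * P ^+ 6)
   - 16%:R * P ^+ 6 * (P1 - 5%:R * P) * H)).
apply/eqP; rewrite -subr_eq0 -(mulr0 48%:R) -j; apply/eqP.
have d1 : qD (P ^+ 3 * P1 ^+ 3) = 3%:R * P ^+ 2 * (P1 - 5%:R * P) * P1 ^+ 3
    + P ^+ 3 * (3%:R * P1 ^+ 2 * (P2 - 5%:R * P1)) by rewrite qDM !qDX qDP qDP1.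
have d2 : qD (c0 * P ^+ 5) = 2%:R * c0 * P ^+ 5 + c0 * (5%:R * P ^+ 4 * (P1 - 5%:R * P)).
  by rewrite qDM qD_c0 qDX qDP.
have d3 : qD (16%:R * (P ^+ 7 * H)) = 16%:R * (7%:R * P ^+ 6 * (P1 - 5%:R * P) * H + P ^+ 7 * qD H).
  by rewrite qDM qD_nat mul0r add0r qDM qDX qDP.
have d4 : qD H = - qD (P ^+ 3 * P1 ^+ 3) + qD (c0 * P ^+ 5)
    + 2%:R * (6%:R * P ^+ 5 * (P1 - 5%:R * P)).
  by rewrite /H !raddfD raddfN /= [qD (_ * P ^+ 6)]qDM qD_nat mul0r add0r qDX qDP.
rewrite d3 d4 d1 d2 /H /U1 /U2.
by ring.
Qed.

Let phi4 x y z u : int := (x + y + (z + u)) ^+ 5 * fq7 (x + y + (z + u)).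

(** A term with two identity weights falls to [pr_tau2], for which one of the other two weights must
    preserve multiples of 7; [fq7] need not, but its partner [cb] does. The types $(5,3,3,1)$ and
    $(3,3,3,3)$ remain, with total coefficients 12 and 1 modulo 7, and form the quartic term. *)
Lemma pr_phi7 : pr 7 5 (P * F4 phi4) = 0.
Proof.
pose t2 f g := P * ((tau R f * tau R g) * (tau R id * tau R id)).
have -> : P * F4 phi4 = 240%:R * t2 fx2 id + 240%:R * t2 fq7 cb - 720%:R * t2 n9 id
   - 240%:R * 113%:R * t2 s7 cb - 72%:R * 396%:R * t2 q5 q5
   + P * (tau R cb ^+ 4 + 12%:R * (tau R q5 * tau R cb ^+ 2 * tau R id)).
  apply: (@eq7 (- (P * (12%:R * 2263%:R * (tau R q5 * tau R cb ^+ 2 * tau R id) + 19%:R * 397%:R * tau R cb ^+ 4)))).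
  rewrite (F4_sum odd4_phi).
  rewrite !big_cat /all4 /all12 /all6 /all12_533 /one3 !big_cons !big_nil /= /t2.
  by rewrite !mulrNz !intrM -!pmulrn; ring.
have d7 (x : int) n : (7 %| x)%Z -> (7 %| x ^+ 2 * n)%Z by move=> h; rewrite dvdz_mulr // dvdz_exp.
have z0 c f g : in_qp 7 c -> (forall x, (7 %| x)%Z -> (7 %| g x)%Z) ->
    pr 7 5 (c * t2 f g) = 0.
  by move=> c7 g7; rewrite pr_in_qpM // pr_tau2 ?mulr0.
have inM (m n : nat) : in_qp 7 (m%:R * n%:R : fps R) by rewrite -natrM.
rewrite !raddfD !raddfN /= pr_quartic addr0.
by rewrite !z0 ?oppr0 ?addr0 // => x /d7; apply.
Qed.

Let sT : summable T. Proof. exact: summableMr. Qed.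

Let pr_w14 (x : fps R) : pr 7 5 (w ^+ 14 * x) = w ^+ 14 * pr 7 5 x.
Proof. by apply: pr_in_qpM; rewrite (exprM w 2 7). Qed.

(** A single factor $(q)$ completes $(q)^{-13}$ to $(q)^{-14}$, a series in $q^7$; it is the factor
    [P] in [pr_phi7]. *)
Theorem pr_appell7 : pr 7 5 (appell R * w) = 0.
Proof.
apply: (@pr_appell_eq0 R 7 4 _ _ _ p0 5 _ _ T s
  (fun a => ((a.1.1 + 1, a.1.2 + 1), (a.2.1 + 1, a.2.2 + 1)))
  (fun a => ((1 - a.1.1, 1 - a.1.2), (1 - a.2.1, 1 - a.2.2))) sT _ _ _ _ _ _ T_class7 pr_pinfV7
  (fun x => fq7 (2%:Z * x + 1 - 7%:Z))) => //.
- exists (fun a => ((a.1.1 - 1, a.1.2 - 1), (a.2.1 - 1, a.2.2 - 1))) => -[[a b] [c d]] /=;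
    by congr (_, _, (_, _)); lia.
- by move=> [[a b] [c d]] /=; congr (_, _, (_, _)); lia.
- by move=> [[a b] [c d]]; rewrite /s /=; lia.
- move=> [a b] u v e; rewrite /T !(mulrCA (qpow _) (w ^+ 13)); congr (_ * _).
  have [u1 [v1 e1]] := nat_diff (a.1 + a.2); have [u2 [v2 e2]] := nat_diff (b.1 + b.2).
  have e' : u%:Z - v%:Z = (a.1 + a.2) + (b.1 + b.2) by rewrite e /s /=; ring.
  rewrite -e1 -e2 in e'; apply: (@qpow_shift _ _ _ (u1 + u2) (v1 + v2)); last by lia.
  rewrite /th4 !qpowD /= mulrACA (th2_shift R e1) (th2_shift R e2); ring.
- by move=> [[a b] [c d]]; rewrite /s /=; lia.
- by move=> [[a b] [c d]]; rewrite /T /th4 /th2 /= !th_flip !mulrNN.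
- move=> x; apply/eqP; rewrite eqz_mod_dvd.
  set y : int := 2%:Z * x + 1 - 7%:Z.
  have -> : 2%:Z * (x + 7%:Z) + 1 - 7%:Z = y + 7%:Z * 2%:Z by rewrite /y; ring.
  rewrite fq7D fq7_7M; apply/dvdzP; exists (- (49%:Z * 343%:Z * 2%:Z ^+ 7)
    - 2%:Z * y * (y + 14%:Z) * (y ^+ 2 + y * 14%:Z + 14%:Z ^+ 2) ^+ 2).
  by ring.
pose G a := odd_wt R (s a) ^+ 5 * (fq7 (2%:Z * s a + 1 - 7%:Z))%:~R * T a.
have GE : gsum G = w ^+ 14 * (P * F4 phi4).
  transitivity ((P * w) * w ^+ 13 * F4 phi4); last by ring.
  rewrite Pw mul1r /F4 /wsum -gsumMl; last exact: summableMr.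
  apply: eq_gsum => a; rewrite /G /T /phi4.
  have -> : 2%:Z * s a + 1 - 7%:Z = X a.1.1 + X a.1.2 + (X a.2.1 + X a.2.2).
    by rewrite /s /X; ring.
  have -> : odd_wt R (s a) = (X a.1.1 + X a.1.2 + (X a.2.1 + X a.2.2))%:~R.
    rewrite /odd_wt; apply: int7; apply/eqP; rewrite eqz_mod_dvd; apply/dvdzP; exists 1.
    by rewrite /s /X; ring.
  by rewrite rmorphM rmorphXn /=; ring.
transitivity (pr 7 5 (gsum G)); last by rewrite GE pr_w14 pr_phi7 mulr0.
rewrite gsum_pr; last exact: summableMr.
apply: eq_gsum => a.
by rewrite /G pr_in_qpM //; apply: in_qpM => //; apply: in_qpX; apply: in_qp_int.
Qed.
End Mod7.

(** * The congruences *)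

Lemma spt_dvd (p r : nat) : prime p -> pr p r (pinf^-1 : fps 'F_p) = 0 ->
  pr p r (appell 'F_p * pinf^-1) = 0 ->
  forall n, (n = r %[mod p])%N -> (p %| spt n)%N.
Proof.
move=> p_prime pP pA n nr; have ch := pchar_Fp p_prime.
have E : spt_series 'F_p = qD pinf^-1 + appell 'F_p * pinf^-1.
  apply: (mulrI (pinf_unit 'F_p)); rewrite pinf_spt lam_pinf mulrDr; congr (_ + _).
  by rewrite mulrCA divrr ?pinf_unit // mulr1.
have P0 : coefs (pinf^-1 : fps 'F_p) n = 0.
  by have /(congr1 (fun x => coefs x n)) := pP; rewrite coef_pr nr eqxx.
have A0 : coefs (appell 'F_p * pinf^-1) n = 0.
  by have /(congr1 (fun x => coefs x n)) := pA; rewrite coef_pr nr eqxx.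
have : coefs (spt_series 'F_p) n = 0 by rewrite E coefsD coef_qD P0 A0 mulr0 addr0.
by move=> e; rewrite (dvdn_pcharf ch); apply/eqP.
Qed.

Lemma fps_char p : prime p -> p%:R = 0 :> fps 'F_p.
Proof.
move=> p_prime; apply: fpsP => n; rewrite -[p%:R]mulr1 coefs_natM.
by have /andP[_ /eqP ->] := pchar_Fp p_prime; rewrite mul0r.
Qed.

Local Close Scope ring_scope.

Theorem corollary3p2 (n : nat) :
  spt (5 * n + 4) = 0 %[mod 5] /\ spt (7 * n + 5) = 0 %[mod 7].
Proof.
have p5 := fps_char (isT : prime 5); have p7 := fps_char (isT : prime 7).
rewrite !mod0n; split; apply/eqP; rewrite -/(dvdn _ _).
  apply: (spt_dvd (isT : prime 5) (pr_pinfV5 p5) (pr_appell5 p5)).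
  by rewrite mulnC modnMDl.
apply: (spt_dvd (isT : prime 7) (pr_pinfV7 p7) (pr_appell7 p7)).
by rewrite mulnC modnMDl.
Qed.
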